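(* Let $(M^{2m},\varphi,g)$ be a para-Kähler-Norden manifold, $TM$ its tangent bundle equipped with the $\varphi$-Sasaki metric $g^\varphi$, and $F$ a $(1,1)$-tensor field on $M$. A curve $\Gamma=(\gamma(t),\xi(t))$ on $TM$ is an ${}^{H}F$-geodesic with respect to $\widetilde\nabla$ if and only if $$\gamma_t''=R(\xi_t',\varphi\xi)\gamma_t'+F\gamma_t',\qquad \xi_t''=F\xi_t' .$$
   Context: A para-Kähler-Norden manifold $(M^{2m},\varphi,g)$ is a $2m$-dimensional Riemannian manifold $(M,g)$ with a $(1,1)$-tensor field $\varphi$ such that $\varphi^2=\mathrm{id}$, $\varphi\ne\pm\mathrm{id}$, the $+1$ and $-1$ eigenbundles of $\varphi$ have equal rank, $g(\varphi X,Y)=g(X,\varphi Y)$, and $\nabla\varphi=0$, where $\nabla$ is the Levi-Civita connection of $g$. $R(X,Y)Z=\nabla_X\nabla_YZ-\nabla_Y\nabla_XZ-\nabla_{[X,Y]}Z$. Points of $TM$ are written $(x,\xi)$; ${}^{H}X$, ${}^{V}X$ are the horizontal (with respect to $\nabla$) and vertical lifts to $TM$. The $\varphi$-Sasaki metric $g^\varphi$ on $TM$ is defined by $g^\varphi({}^HX,{}^HY)=g(X,Y)$, $g^\varphi({}^HX,{}^VY)=0$, $g^\varphi({}^VX,{}^VY)=g(X,\varphi Y)$; $\widetilde\nabla$ is its Levi-Civita connection. The horizontal lift ${}^HF$ of $F$ is the $(1,1)$-tensor field on $TM$ with ${}^HF({}^HX)={}^H(FX)$ and ${}^HF({}^VX)={}^V(FX)$.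 A curve $\Gamma=(\gamma(t),\xi(t))$ consists of a curve $\gamma$ on $M$ and a vector field $\xi$ along $\gamma$. Write $\gamma_t'=d\gamma/dt$, $\gamma_t''=\nabla_{\gamma_t'}\gamma_t'$, $\xi_t'=\nabla_{\gamma_t'}\xi$, $\xi_t''=\nabla_{\gamma_t'}\xi_t'$; then $\Gamma_t'={}^H\gamma_t'+{}^V\xi_t'$. $\Gamma$ is an ${}^HF$-geodesic with respect to $\widetilde\nabla$ if $\widetilde\nabla_{\Gamma_t'}\Gamma_t'={}^HF\,\Gamma_t'$. *)

(* Defs.v *)
From HB Require Import structures.
From mathcomp Require Import all_boot all_order all_algebra.
From mathcomp Require Import all_classical all_reals all_analysis.
Set Implicit Arguments.
Unset Strict Implicit.
Unset Printing Implicit Defensive.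
Import Order.TTheory GRing.Theory Num.Theory.
Import numFieldNormedType.Exports.
Local Open Scope classical_set_scope.
Local Open Scope ring_scope.

Section Smooth.
Context {R : realType} {V W : normedModType R}.

Fixpoint Ck (k : nat) (U : set V) (f : V -> W) : Prop :=
  if k is k'.+1 then
    (forall x, U x -> differentiable f x) /\ (forall v, Ck k' U ('D_v f))
  else forall x, U x -> {for x, continuous f}.

(* C^oo on U; meant for open U, the values of f outside U are irrelevant. *)
Definition smooth_on (U : set V) (f : V -> W) : Prop := forall k, Ck k U f.

End Smooth.

(* Charts on T modelled on R^n.  As T_p is represented by the components of
   its vectors in one distinguished chart pchart p around p, every tangent
   space is 'cV[R]_n as a type.  chart_pt i is the inverse of chart_coord i on
   its image and is arbitrary elsewhere. *)
Record charted (R : realType) (n : nat) (T : Type) := Charted {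
  chart : Type;
  chart_dom : chart -> set T;
  chart_coord : chart -> T -> 'cV[R]_n;
  chart_pt : chart -> 'cV[R]_n -> T;
  pchart : T -> chart
}.

Section Charts.
Context {R : realType} {n : nat} {T : Type} (C : charted R n T).
Local Notation vec := 'cV[R]_n.

Definition chart_img (i : chart C) : set vec := chart_coord i @` chart_dom i.

Definition chart_overlap (i j : chart C) : set vec :=
  chart_coord i @` (chart_dom i `&` chart_dom j).

Definition transition (i j : chart C) : vec -> vec :=
  chart_coord j \o chart_pt i.

(* Components in chart i of v : T_p, and the tangent vector at the point of
   coordinates x in chart i whose components in chart i are u. *)
Definition to_chart (i : chart C) (p : T) (v : vec) : vec :=
  'D_v (transition (pchart C p) i) (chart_coord (pchart C p) p).

Definition of_chart (i : chart C) (x u : vec) : vec :=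
  'D_u (transition i (pchart C (chart_pt i x))) x.

Definition endo_in (F : T -> vec -> vec) (i : chart C) (x u : vec) : vec :=
  to_chart i (chart_pt i x) (F (chart_pt i x) (of_chart i x u)).

Definition form_in (g : T -> vec -> vec -> R) (i : chart C) (x u v : vec) : R :=
  g (chart_pt i x) (of_chart i x u) (of_chart i x v).

Record tensor11 (F : T -> vec -> vec) : Prop := {
  tensor11_linear : forall p, linear (F p);
  tensor11_smooth : forall i u, smooth_on (chart_img i) (endo_in F i ^~ u)
}.

Record riemannian (g : T -> vec -> vec -> R) : Prop := {
  riem_linear : forall p v, linear (fun u => g p u v : R^o);
  riem_sym : forall p u v, g p u v = g p v u;
  riem_pos : forall p u, u != 0 -> 0 < g p u u;
  riem_smooth : forall i u v,
    smooth_on (chart_img i) (fun x => form_in g i x u v : R^o)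
}.

(* D i k a b x is the Christoffel symbol Gamma^k_ab, at the point of
   coordinates x in chart i; that is, nabla_(d_a) d_b = Gamma^k_ab d_k. *)
Definition symbols := chart C -> 'I_n -> 'I_n -> 'I_n -> vec -> R.

Implicit Type D : symbols.

Definition christoffel D (i : chart C) (x u v : vec) : vec :=
  \col_k \sum_a \sum_b D i k a b x * u a 0 * v b 0.

Record connection D : Prop := {
  conn_smooth : forall i k a b,
    smooth_on (chart_img i) (D i k a b : vec -> R^o);
  conn_change : forall i j x u v, chart_overlap i j x ->
    'D_(christoffel D i x u v) (transition i j) x
    = 'D_u ('D_v (transition i j)) x
      + christoffel D j (transition i j x)
          ('D_u (transition i j) x) ('D_v (transition i j) x)
}.

(* Here vector fields X, Y, Z on the domain of chart i are given by their
   components, as functions of the coordinates. *)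
Definition bracket (X Y : vec -> vec) (x : vec) : vec :=
  'D_(X x) Y x - 'D_(Y x) X x.

Definition nabla D (i : chart C) (X Y : vec -> vec) (x : vec) : vec :=
  'D_(X x) Y x + christoffel D i x (X x) (Y x).

Definition curvature_field D (i : chart C) (X Y Z : vec -> vec) (x : vec) : vec :=
  nabla D i X (nabla D i Y Z) x - nabla D i Y (nabla D i X Z) x
  - nabla D i (bracket X Y) Z x.

(* R(u, v)w in T_p: u, v, w are extended around p to vector fields with
   constant components, the value being independent of the extension. *)
Definition curvature D (p : T) (u v w : vec) : vec :=
  curvature_field D (pchart C p) (cst u) (cst v) (cst w)
    (chart_coord (pchart C p) p).

Definition torsion_free D : Prop :=
  forall i (X Y : vec -> vec),
    smooth_on (chart_img i) X -> smooth_on (chart_img i) Y ->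
  forall x, chart_img i x ->
    nabla D i X Y x - nabla D i Y X x = bracket X Y x.

Definition metric_connection D (g : T -> vec -> vec -> R) : Prop :=
  forall i (X Y Z : vec -> vec),
    smooth_on (chart_img i) X -> smooth_on (chart_img i) Y ->
    smooth_on (chart_img i) Z ->
  forall x, chart_img i x ->
    'D_(X x) (fun y => form_in g i y (Y y) (Z y) : R^o) x
    = form_in g i x (nabla D i X Y x) (Z x)
      + form_in g i x (Y x) (nabla D i X Z x).

(* g may be indefinite: this is also used for the metric of TM. *)
Record levi_civita D (g : T -> vec -> vec -> R) : Prop := {
  lc_connection : connection D;
  lc_torsion_free : torsion_free D;
  lc_metric : metric_connection D g
}.

(* nabla F = 0, i.e. nabla_X (F Y) = F (nabla_X Y). *)
Definition parallel11 D (F : T -> vec -> vec) : Prop :=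
  forall i (X Y : vec -> vec),
    smooth_on (chart_img i) X -> smooth_on (chart_img i) Y ->
  forall x, chart_img i x ->
    nabla D i X (fun y => endo_in F i y (Y y)) x
    = endo_in F i x (nabla D i X Y x).

(* A curve is defined on the open interval J (and arbitrary outside J); a
   vector field along c maps t to an element of T_(c t). *)
Definition smooth_curve (J : set R) (c : R -> T) : Prop :=
  forall i : chart C, open (J `&` c @^-1` chart_dom i) /\
    smooth_on (J `&` c @^-1` chart_dom i : set R^o) (chart_coord i \o c).

Definition smooth_along (J : set R) (c : R -> T) (W : R -> vec) : Prop :=
  forall i : chart C, smooth_on (J `&` c @^-1` chart_dom i : set R^o)
    (fun t => to_chart i (c t) (W t)).

Definition velocity (c : R -> T) (t : R) : vec :=
  derive1 (chart_coord (pchart C (c t)) \o c) t.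

Definition covariant_derivative D (c : R -> T) (W : R -> vec) (t : R) : vec :=
  let i := pchart C (c t) in
  derive1 (fun s => to_chart i (c s) (W s)) t
  + christoffel D i (chart_coord i (c t)) (velocity c t) (W t).

Definition F_geodesic D (F : T -> vec -> vec) (J : set R) (c : R -> T) : Prop :=
  forall t, J t ->
    covariant_derivative D c (velocity c) t = F (c t) (velocity c t).

End Charts.

Record smooth_manifold (R : realType) (n : nat) (T : topologicalType)
    (C : charted R n T) : Prop := {
  mfd_hausdorff : hausdorff_space T;
  mfd_second_countable : @second_countable T;
  mfd_pchart : forall p, chart_dom (pchart C p) p;
  mfd_dom_open : forall i : chart C, open (chart_dom i);
  mfd_img_open : forall i : chart C, open (chart_img i);
  mfd_coordK : forall (i : chart C) p, chart_dom i p ->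
    chart_pt i (chart_coord i p) = p;
  mfd_coord_continuous : forall (i : chart C) p, chart_dom i p ->
    {for p, continuous (@chart_coord _ _ _ C i)};
  mfd_pt_continuous : forall (i : chart C) x, chart_img i x ->
    {for x, continuous (@chart_pt _ _ _ C i)};
  mfd_transition : forall i j : chart C,
    smooth_on (chart_overlap i j) (transition i j)
}.

Record para_Kahler_Norden (R : realType) (m : nat) (T : topologicalType)
    (C : charted R (m + m) T) (g : T -> 'cV[R]_(m + m) -> 'cV[R]_(m + m) -> R)
    (D : symbols C) (phi : T -> 'cV[R]_(m + m) -> 'cV[R]_(m + m)) : Prop := {
  pkn_manifold : smooth_manifold C;
  pkn_metric : riemannian C g;
  pkn_levi_civita : levi_civita D g;
  pkn_tensor : tensor11 C phi;
  pkn_invol : forall p u, phi p (phi p u) = u;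
  pkn_neq_id : phi <> (fun _ u => u);
  pkn_neq_opp : phi <> (fun _ u => - u);
  pkn_rank : forall p,
    \dim (passmx.leigenspace (linfun (phi p)) 1)
    = \dim (passmx.leigenspace (linfun (phi p)) (-1));
  pkn_pure : forall p u v, g p (phi p u) v = g p u (phi p v);
  pkn_parallel : parallel11 D phi
}.

Section TangentBundle.
Context {R : realType} {n : nat} {T : Type} (C : charted R n T).
Local Notation vec := 'cV[R]_n.
Local Notation vec2 := 'cV[R]_(n + n).

(* TM as the set of pairs (p, xi) with xi : T_p, with the charts
   (x^1, ..., x^n, xi^1, ..., xi^n) induced by those of M. *)
Definition tangent_bundle : charted R (n + n) (T * vec) := {|
  chart := chart C;
  chart_dom := fun i => [set z | chart_dom i z.1];
  chart_coord := fun i z => col_mx (chart_coord i z.1) (to_chart i z.1 z.2);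
  chart_pt := fun i y =>
    (chart_pt i (usubmx y), of_chart i (usubmx y) (dsubmx y));
  pchart := fun z => pchart C z.1
|}.

Variable D : symbols C.

Definition vlift (z : T * vec) (u : vec) : vec2 := col_mx 0 u.

Definition hlift (z : T * vec) (u : vec) : vec2 :=
  let i := pchart C z.1 in
  col_mx u (- christoffel D i (chart_coord i z.1) u z.2).

(* A = hlift z (hpart A) + vlift z (vpart z A), see liftK. *)
Definition hpart (A : vec2) : vec := usubmx A.

Definition vpart (z : T * vec) (A : vec2) : vec :=
  let i := pchart C z.1 in
  dsubmx A + christoffel D i (chart_coord i z.1) (usubmx A) z.2.

Definition phi_sasaki (phi : T -> vec -> vec) (g : T -> vec -> vec -> R)
    (z : T * vec) (A B : vec2) : R :=
  g z.1 (hpart A) (hpart B) + g z.1 (vpart z A) (phi z.1 (vpart z B)).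

Definition hlift11 (F : T -> vec -> vec) (z : T * vec) (A : vec2) : vec2 :=
  hlift z (F z.1 (hpart A)) + vlift z (F z.1 (vpart z A)).

Lemma christoffel0 i x v : christoffel D i x 0 v = 0.
Proof.
apply/matrixP => k j; rewrite !mxE big1 // => a _; rewrite big1 // => b _.
by rewrite mxE mulr0 mul0r.
Qed.

Lemma liftK z A : hlift z (hpart A) + vlift z (vpart z A) = A.
Proof.
rewrite /hlift /vlift /hpart /vpart /= add_col_mx addr0 addrCA addNr addr0.
exact: vsubmxK.
Qed.

Lemma hpart_hlift z u : hpart (hlift z u) = u.
Proof. exact: col_mxKu. Qed.

Lemma vpart_hlift z u : vpart z (hlift z u) = 0.
Proof. by rewrite /vpart /hlift /= col_mxKu col_mxKd addNr. Qed.

Lemma hpart_vlift z u : hpart (vlift z u) = 0.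
Proof. exact: col_mxKu. Qed.

Lemma vpart_vlift z u : vpart z (vlift z u) = u.
Proof. by rewrite /vpart /vlift /= col_mxKu col_mxKd christoffel0 addr0. Qed.

Definition lift_partE := (hpart_hlift, vpart_hlift, hpart_vlift, vpart_vlift).

Section DefiningIdentities.
Variables (phi F : T -> vec -> vec) (g : T -> vec -> vec -> R).
Hypotheses (g0l : forall p v, g p 0 v = 0) (g0r : forall p v, g p v 0 = 0).
Hypotheses (phi0 : forall p, phi p 0 = 0) (F0 : forall p, F p 0 = 0).

Lemma phi_sasaki_HH z u v :
  phi_sasaki phi g z (hlift z u) (hlift z v) = g z.1 u v.
Proof. by rewrite /phi_sasaki !lift_partE g0l addr0. Qed.

Lemma phi_sasaki_HV z u v : phi_sasaki phi g z (hlift z u) (vlift z v) = 0.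
Proof. by rewrite /phi_sasaki !lift_partE g0l g0r addr0. Qed.

Lemma phi_sasaki_VH z u v : phi_sasaki phi g z (vlift z u) (hlift z v) = 0.
Proof. by rewrite /phi_sasaki !lift_partE phi0 g0l g0r addr0. Qed.

Lemma phi_sasaki_VV z u v :
  phi_sasaki phi g z (vlift z u) (vlift z v) = g z.1 u (phi z.1 v).
Proof. by rewrite /phi_sasaki !lift_partE g0l add0r. Qed.

Lemma hlift11_H z u : hlift11 F z (hlift z u) = hlift z (F z.1 u).
Proof. by rewrite /hlift11 !lift_partE F0 /vlift col_mx0 addr0. Qed.

Lemma hlift11_V z u : hlift11 F z (vlift z u) = vlift z (F z.1 u).
Proof.
by rewrite /hlift11 !lift_partE F0 /hlift christoffel0 oppr0 col_mx0 add0r.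
Qed.

End DefiningIdentities.
End TangentBundle.

(* Main.v *)
Require Import Defs.
From HB Require Import structures.
From mathcomp Require Import all_boot all_order all_algebra.
From mathcomp Require Import all_classical all_reals all_analysis.
From mathcomp Require Import ring lra.
Set Implicit Arguments.
Unset Strict Implicit.
Unset Printing Implicit Defensive.
Import Order.TTheory GRing.Theory Num.Theory.
Import numFieldNormedType.Exports.
Local Open Scope classical_set_scope.
Local Open Scope ring_scope.

(* In a bundle chart (x, w) write vert A = b + Gamma_x(a, w) for A = (a, b); then
   the phi-Sasaki metric is g_x(a, a') + h_x(vert A, vert B), where the form
   h = g(., phi .) is symmetric and, like g, parallel.  Koszul's formula for
   constant fields gives, for its Christoffel symbols K,
     G(K(A, A), B) = g(Gamma(a, a), a') + h(nabla_A vert A, vert B)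
                     + h(vert A, R(a, a')w).
   As h is parallel, R(a, a') is skew for h, so the last term equals
   - g(R(a, a') vert A, phi w) = - g(R(vert A, phi w)a, a') by pair symmetry.  Hence
   the acceleration of (gamma, xi) has horizontal part
   gamma'' - R(xi', phi xi)gamma' and vertical part xi''. *)

(** * Derivatives *)

(** The Levi-Civita connection of the phi-Sasaki metric is never written out. A geodesic equation
    sees only the diagonal K(A, A), and there Koszul's formula reduces to two instances of metric
    compatibility. Since G need not be definite, an error in K(A, A) is not killed by pairing it
    with itself; the vertical entry of the test vector is twisted by phi, and phi^2 = id then turns
    the pairing into a sum of two squares for g. The other obstacle is coordinates. A tangent vector
    at p is stored by its components in the distinguished chart of p, and this chart may jump from
    one point to the next. Whatever is differentiated is therefore first moved to one fixed chart.
    The second derivatives of transition maps that this produces are absorbed by the transformation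
    law of the Christoffel symbols. *)

Section DirectionalDerivative.
Context {R : realType}.

Lemma is_derive_scale_fun {E W : normedModType R} (k : E -> R) (f : E -> W)
    (z A : E) dk df :
  is_derive z A (k : E -> R^o) dk -> is_derive z A f df ->
  is_derive z A (fun y => k y *: f y) (k z *: df + dk *: f z).
Proof.
move=> [dvk <-] [dvf <-].
have H : (fun h => h^-1 *: (((fun y => k y *: f y) \o shift z) (h *: A) - k z *: f z))
    @ 0^' --> k z *: 'D_A f z + 'D_A (k : E -> R^o) z *: f z.
  rewrite [X in X @ _](_ : _ = fun h =>
    k (h *: A + z) *: (h^-1 *: (f (h *: A + z) - f z))
    + (h^-1 *: (k (h *: A + z) - k z : R^o)) *: f z); last first.
    rewrite funeqE => h /=.
    have -> (c d : R) w : (c *: (d : R^o)) *: w = c *: (d *: w) by rewrite scalerA.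
    rewrite [X in _ = X + _]scalerA [X in _ = X *: _ + _]mulrC -scalerA -scalerDr.
    by congr (_ *: _); rewrite scalerBr scalerBl addrA subrK.
  apply: cvgD; last by apply: cvgZr_tmp; exact: dvk.
  apply: cvgZ; last exact: dvf.
  (* Only a derivative of [k] in the direction [A] is given; it yields continuity of [k] along the
     line through [z], the only place where the quotient evaluates it. *)
  suff : {for 0, continuous (fun h : R => k (h *: A + z))}.
    by move=> /continuous_withinNx; rewrite scale0r add0r.
  exact/differentiable_continuous/derivable1_diffP/(derivable1P _ _ _).1.
split; last exact: (cvg_lim _ H).
by apply/cvg_ex; eexists; exact: H.
Qed.

(** [p] has a derivative in one direction only, so the chain rule for differentials does not apply
    to it directly. Along the line [h *: A + z] it becomes a function of one real variable, for
    which derivable and differentiable agree. *)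
Lemma is_derive_comp {E V W : normedModType R} (p : E -> V) (f : V -> W)
    (z A : E) dp :
  is_derive z A p dp -> differentiable f (p z) ->
  is_derive z A (f \o p) ('D_dp f (p z)).
Proof.
move=> [dvp <-] df.
pose q (h : R) := p (h *: A + z).
have q0 : q 0 = p z by rewrite /q scale0r add0r.
have dq : differentiable q 0.
  by case: (derivable1_diffP q 0) => + _; apply; exact: ((derivable1P p z A).1 dvp).
have dqE : 'D_1 q 0 = 'D_A p z.
  rewrite /derive; set g1 := fun h => h^-1 *: _; set g2 := fun h => h^-1 *: _.
  suff -> : g1 = g2 by [].
  by apply/funext => h; rewrite /g1 /g2 /q /= addr0 scale0r add0r [_%:A]mulr1.
have dfq : differentiable f (q 0) by rewrite q0.
have dfqc : differentiable (f \o q) 0 by exact: differentiable_comp.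
have fqE : 'D_A (f \o p) z = 'D_1 (f \o q) 0.
  rewrite /derive; set g1 := fun h => h^-1 *: _; set g2 := fun h => h^-1 *: _.
  suff -> : g1 = g2 by [].
  by apply/funext => h; rewrite /g1 /g2 /q /= addr0 scale0r add0r [_%:A]mulr1.
split.
  apply/derivable1P.
  exact/(@derivable1_diffP _ _ (f \o q)).
by rewrite fqE (deriveE _ dfqc) diff_comp//= -(deriveE _ dq) dqE -(deriveE _ dfq) q0.
Qed.

Lemma cV_expand n (u : 'cV[R]_n) : u = \sum_a u a 0 *: delta_mx a 0.
Proof. by rewrite {1}[u]matrix_sum_delta; apply: eq_bigr => i _; rewrite big_ord1. Qed.

Lemma linear_expand {W : lmodType R} n (f : 'cV[R]_n -> W) u : linear f ->
  f u = \sum_a u a 0 *: f (delta_mx a 0).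
Proof.
move=> lf; pose fM := GRing.isLinear.Build _ _ _ _ f lf.
pose fL : {linear _ -> _} := HB.pack f fM.
rewrite -[f]/(fL : _ -> _) {1}[u]cV_expand linear_sum.
by apply: eq_bigr => a _; rewrite linearZ.
Qed.

Lemma is_derive_coord {E : normedModType R} m n (f : E -> 'M[R]_(m, n)) z A df i j :
  is_derive z A f df -> is_derive z A (fun y => f y i j : R^o) (df i j).
Proof.
move=> [dvf <-]; have /derivable_mxP/(_ i j) fij := dvf; split => //.
by rewrite derive_mx// mxE.
Qed.

Lemma is_derive_mx {E : normedModType R} m n (f : E -> 'M[R]_(m, n)) z A
    (df : 'M[R]_(m, n)) :
  (forall i j, is_derive z A (fun y => f y i j : R^o) (df i j)) -> is_derive z A f df.
Proof.
move=> H; have dvf : derivable f z A.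
  by apply/derivable_mxP => i j; have [] := H i j.
split => //; rewrite derive_mx//; apply/matrixP => i j; rewrite mxE.
by have [_ <-] := H i j.
Qed.

(** In a basis the value [L y (q y)] is a finite sum of products, so the derivatives of [L] at fixed
    vectors determine everything. Christoffel symbols, metrics and differentials of transition maps
    all enter through this rule. *)
Lemma is_derive_lin_app {E W : normedModType R} n (L : E -> 'cV[R]_n -> W)
    (q : E -> 'cV[R]_n) z A dq dL :
  (\forall y \near z, linear (L y)) ->
  is_derive z A (fun y => L y (q z)) dL ->
  (forall u, derivable (fun y => L y u) z A) ->
  is_derive z A q dq ->
  is_derive z A (fun y => L y (q y)) (dL + L z dq).
Proof.
move=> lin [_ <-] dvL dvq.
pose S (r : 'cV[R]_n) y := \sum_a r a 0 *: L y (delta_mx a 0).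
have dS : is_derive z A (fun y => S (q y) y)
    (\sum_a ((q z) a 0 *: 'D_A (L ^~ (delta_mx a 0)) z + dq a 0 *: L z (delta_mx a 0))).
  rewrite [X in is_derive _ _ X _](_ : _ =
    \sum_a (fun y => q y a 0 *: L y (delta_mx a 0))); last first.
    by apply/funext => y; rewrite fct_sumE.
  apply: is_derive_sum => a; apply: is_derive_scale_fun.
    exact: is_derive_coord.
  exact: derivableP.
have dS' : is_derive z A (S (q z)) (\sum_a ((q z) a 0 *: 'D_A (L ^~ (delta_mx a 0)) z)).
  rewrite [X in is_derive _ _ X _](_ : _ =
    \sum_a ((q z a 0) \*: (fun y => L y (delta_mx a 0)))); last first.
    by apply/funext => y; rewrite fct_sumE.
  by apply: is_derive_sum => a; apply: is_deriveZ; exact: derivableP.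
apply: near_eq_is_derive.
  by near=> y; rewrite (_ : L y (q y) = S (q y) y)//; apply: linear_expand; near: y.
rewrite (_ : _ + _ = \sum_a ((q z) a 0 *: 'D_A (L ^~ (delta_mx a 0)) z
  + dq a 0 *: L z (delta_mx a 0)))//.
rewrite big_split/=; congr (_ + _).
  rewrite -(@derive_val _ _ _ _ _ _ _ dS').
  apply: near_eq_derive; near=> y; apply: linear_expand; near: y.
  exact: lin.
by apply: linear_expand; exact: nbhs_singleton lin.
Unshelve. all: by end_near. Qed.

Lemma is_derive_bilin_app {E W : normedModType R} m n
    (B : E -> 'cV[R]_m -> 'cV[R]_n -> W)
    (p : E -> 'cV[R]_m) (q : E -> 'cV[R]_n) z A dp dq dB :
  (\forall y \near z, forall v, linear (B y ^~ v)) ->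
  (\forall y \near z, forall u, linear (B y u)) ->
  is_derive z A (fun y => B y (p z) (q z)) dB ->
  (forall u v, derivable (fun y => B y u v) z A) ->
  is_derive z A p dp -> is_derive z A q dq ->
  is_derive z A (fun y => B y (p y) (q y)) (dB + B z (p z) dq + B z dp (q z)).
Proof.
move=> linl linr dvB dvuv dvp dvq.
have H u : is_derive z A (fun y => B y u (q y)) ('D_A (fun y => B y u (q z)) z + B z u dq).
  apply: (@is_derive_lin_app _ _ _ (fun y v => B y u v)) => //.
  by near=> y; move: u; near: y.
apply: (@is_derive_lin_app _ _ _ (fun y u => B y u (q y))) => //.
  near=> y; have : forall v, linear (B y ^~ v) by near: y.
  exact.
by rewrite -(@derive_val _ _ _ _ _ _ _ dvB); exact: H.
Unshelve. all: by end_near. Qed.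

Lemma derive_linear {V W : normedModType R} (f : V -> W) x :
  differentiable f x -> linear (fun v => 'D_v f x).
Proof. by move=> df c u v; rewrite !deriveE// linearP. Qed.

(** With a transition map as [f], this differentiates its tangent map, both along a curve and in the
    bundle charts. The first summand is the second-derivative term that the Christoffel law later
    absorbs. *)
Lemma is_derive_derive_app {E W : normedModType R} n (f : 'cV[R]_n -> W)
    (U : set 'cV[R]_n) (p q : E -> 'cV[R]_n) z A dp dq :
  open U -> U (p z) ->
  (forall x, U x -> differentiable f x) ->
  (forall v x, U x -> differentiable ('D_v f) x) ->
  {for z, continuous p} ->
  is_derive z A p dp -> is_derive z A q dq ->
  is_derive z A (fun y => 'D_(q y) f (p y))
    ('D_dp ('D_(q z) f) (p z) + 'D_dq f (p z)).
Proof.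
move=> oU Upz df ddf cp dvp dvq.
have dfp u : is_derive z A (fun y => 'D_u f (p y)) ('D_dp ('D_u f) (p z)).
  by apply: (is_derive_comp dvp); exact: ddf.
apply: (@is_derive_lin_app _ _ _ (fun y u => 'D_u f (p y))) => //.
have Up : \forall y \near z, U (p y) by apply: cp; exact: open_nbhs_nbhs.
by near=> y; apply/derive_linear/df; near: y.
Unshelve. all: by end_near. Qed.

Lemma is_derive_line {V W : normedModType R} (f : V -> W) (x a : V) (t : R) :
  derivable f (x + t *: a) a ->
  is_derive t 1 (fun s : R => f (x + s *: a)) ('D_a f (x + t *: a)).
Proof.
rewrite /derivable => df.
have E : (fun h : R => h^-1 *: (((fun s : R => f (x + s *: a)) \o shift t) (h *: 1)
    - f (x + t *: a)))
  = (fun h => h^-1 *: ((f \o shift (x + t *: a)) (h *: a) - f (x + t *: a))).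
  apply/funext => h /=; congr (_ *: (f _ - _)).
  by rewrite [h%:A]mulr1 scalerDl addrCA.
by split; rewrite /derivable /derive E.
Qed.

(* Young's form of Schwarz's theorem: both mixed derivatives are limits of the
   second difference quotient, which is symmetric in a and b. *)
Lemma second_difference {V : normedModType R} (f : V -> R) (x a b : V) (e : R) :
  (\forall y \near x, derivable f y a) ->
  differentiable ('D_a f) x -> 0 < e ->
  \forall s \near 0^'+, `|f (x + s *: a + s *: b) - f (x + s *: a)
     - f (x + s *: b) + f x - s ^+ 2 * 'D_b ('D_a f) x| <= e * s ^+ 2.
Proof.
move=> dfa dF e0.
set F1 := 'D_a f.
(* The expansion of [F1] is used at two vectors, of norms at most s|a| and s(|a| + |b|); hence 2|a|
   + |b|. The 1 keeps the denominator positive. *)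
have K0 : 0 < `|a| + `|a| + `|b| + 1 by rewrite ltr_wpDl// !addr_ge0.
have eta0 : 0 < e / (`|a| + `|a| + `|b| + 1) by rewrite divr_gt0.
have /eqaddoP/(_ _ eta0) oF := diff_locally dF.
have dfa' : \forall h \near (0 : V), derivable f (h + x) a.
  by move: dfa; rewrite (near_shift 0) /= subr0.
have HP : \forall h \near (0 : V), `|F1 (h + x) - (F1 x + 'd F1 x h)|
    <= e / (`|a| + `|a| + `|b| + 1) * `|h| /\ derivable f (h + x) a.
  by near=> h; split; near: h.
move: HP => /nbhs_ballP[r /= r0 Hr].
have {}Hr h : `|h| < r -> `|F1 (h + x) - (F1 x + 'd F1 x h)|
    <= e / (`|a| + `|a| + `|b| + 1) * `|h| /\ derivable f (h + x) a.
  by move=> hr; apply: Hr; rewrite -ball_normE /= sub0r normrN.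
near=> s.
have s0 : 0 < s by [].
have sr : s * (`|a| + `|b|) < r.
  have : s < r / (`|a| + `|b| + 1).
    near: s; apply: nbhs_right_lt; rewrite divr_gt0// ltr_wpDl// addr_ge0//.
  rewrite ltr_pdivlMr ?ltr_wpDl ?addr_ge0//; apply: le_lt_trans.
  by rewrite ler_pM2l// lerDl.
have tr t : 0 <= t <= s -> `|t *: a| < r /\ `|t *: a + s *: b| < r.
  move=> /andP[t0 ts].
  have ta : `|t *: a| <= s * `|a| by rewrite normrZ ger0_norm// ler_wpM2r.
  split; first by apply: le_lt_trans sr; rewrite mulrDr (le_trans ta)// lerDl mulr_ge0// ltW.
  apply: le_lt_trans sr; rewrite mulrDr (le_trans (ler_normD _ _))// lerD//.
  by rewrite normrZ gtr0_norm.
(* [phi t] is the increment along [s *: b]. The mean value theorem turns [phi s - phi 0] into [s]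
   times a difference of values of [F1], to which the expansion at [x] applies. *)
pose phi (t : R) := f (x + s *: b + t *: a) - f (x + t *: a).
have dphi t : 0 <= t <= s ->
    is_derive t 1 phi (F1 (x + s *: b + t *: a) - F1 (x + t *: a)).
  move=> /tr[t1 t2]; apply: is_deriveB; apply: is_derive_line.
    by rewrite addrC [x + _]addrC addrA; exact: (Hr _ t2).2.
  by rewrite addrC; exact: (Hr _ t1).2.
have sub t : t \in `]0, s[%R -> 0 <= t <= s.
  by rewrite in_itv/= => /andP[t0 ts]; rewrite !ltW.
have cphi : {within `[0, s], continuous phi}.
  apply: derivable_within_continuous => t; rewrite in_itv/= => ts.
  by have [] := dphi t ts.
have [t /sub ts Et] := MVT s0 (fun t h => dphi t (sub t h)) cphi.
have [t1 t2] := tr t ts.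
have := (Hr _ t2).1; have := (Hr _ t1).1.
have -> : t *: a + s *: b + x = x + s *: b + t *: a by rewrite addrC addrA addrAC.
have dE : 'd F1 x (t *: a + s *: b) = 'd F1 x (t *: a) + s * 'D_b F1 x.
  by rewrite linearD [X in _ + X = _]linearZ/= -(deriveE b dF).
rewrite [t *: a + x]addrC dE.
move: Et; rewrite /phi scale0r !addr0 subr0.
set v := F1 (x + s *: b + _); set u := F1 (x + _); set w := 'd _ _ _; set c := 'D_b F1 x.
move=> Et b1 b2.
rewrite (addrAC x) in Et.
have -> : f (x + s *: a + s *: b) - f (x + s *: a) - f (x + s *: b) + f x - s ^+ 2 * c
    = s * ((v - (F1 x + (w + s * c))) - (u - (F1 x + w))).
  rewrite [RHS](_ : _ = (v - u) * s - s ^+ 2 * c); last by ring.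
  by rewrite -Et; ring.
rewrite normrM gtr0_norm// expr2 mulrCA ler_pM2l//.
rewrite (le_trans (ler_normB _ _))// (le_trans (lerD b2 b1))// -mulrDr.
rewrite -mulrA ler_pM2l// ler_pdivrMl//.
have tas : `|t *: a| <= s * `|a|.
  by case/andP: ts => t0 ts; rewrite normrZ ger0_norm// ler_wpM2r.
rewrite (le_trans (lerD (ler_normD _ _) (lexx _)))//.
rewrite (le_trans (lerD (lerD tas (lexx _)) tas))// normrZ gtr0_norm//.
by rewrite -!mulrDr mulrC ler_pM2r// addrAC lerDl.
Unshelve. all: by end_near. Qed.

Lemma derive_comm {V : normedModType R} (f : V -> R) (x a b : V) :
  (\forall y \near x, derivable f y a) -> (\forall y \near x, derivable f y b) ->
  differentiable ('D_a f) x -> differentiable ('D_b f) x ->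
  'D_b ('D_a f) x = 'D_a ('D_b f) x.
Proof.
move=> fa fb dfa dfb; apply/eqP; rewrite -subr_eq0 -normr_le0.
apply/ler_addgt0Pl => e e0; rewrite addr0.
have e20 : 0 < e / 2 by rewrite divr_gt0.
pose Q (s : R) := f (x + s *: a + s *: b) - f (x + s *: a) - f (x + s *: b) + f x.
have Ha : \forall s \near (0 : R)^'+,
    `|Q s - s ^+ 2 * 'D_b ('D_a f) x| <= e / 2 * s ^+ 2.
  exact: second_difference.
have Hb : \forall s \near (0 : R)^'+,
    `|Q s - s ^+ 2 * 'D_a ('D_b f) x| <= e / 2 * s ^+ 2.
  apply: filterS (second_difference a fb dfb e20) => s.
  by rewrite /Q (addrAC x) (addrAC (f _)).
(* One positive [s] is enough: both derivatives, scaled by s^2, lie within (e/2) s^2 of the same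
   number [Q s]. *)
have [s [[/= s0 h1] h2]] := filter_ex (filterI (filterI (nbhs_right_gt (0 : R)) Ha) Hb).
have s20 : 0 < s ^+ 2 by rewrite exprn_gt0.
rewrite -(ler_pM2r s20) -[X in _ * X <= _](gtr0_norm s20) -normrM.
set u := 'D_b _ _; set v := 'D_a _ _.
have -> : (u - v) * s ^+ 2 = (Q s - s ^+ 2 * v) - (Q s - s ^+ 2 * u) by ring.
apply: le_trans (ler_normB _ _) _; apply: le_trans (lerD h2 h1) _.
by rewrite -mulrDl -splitr.
Qed.

End DirectionalDerivative.

(** * Differentiability in all directions at once *)

Section Differentiability.
Context {R : realType}.

Lemma near_eq_differentiable {V W : normedModType R} (f g : V -> W) x :
  (\forall y \near x, f y = g y) -> differentiable f x -> differentiable g x.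
Proof.
move=> fg df.
have fgx : f x = g x := nbhs_singleton fg.
have H : g \o shift x = cst (g x) + 'd f x +o_ 0 id.
  apply/eqaddoP => e e0.
  have /eqaddoP/(_ e e0) oF := diff_locally df.
  have fg0 : \forall h \near (0 : V), f (h + x) = g (h + x).
    by move: fg; rewrite (near_shift 0) /= subr0.
  apply: filterS2 fg0 oF => h fgh.
  by rewrite -fgx -[(f \o shift x - _) h]/(f (h + x) - _) fgh.
have dgE : 'd g x = 'd f x :> (V -> W) by apply: diff_unique H; exact: diff_continuous.
by apply/diff_locallyP; rewrite dgE; split => //; exact: diff_continuous.
Qed.

(** [derive_comm] asks for differentiable first derivatives, which directional Leibniz rules do not
    provide; the same basis expansion does. *)
Lemma differentiable_lin_app {V : normedModType R} n (L : V -> 'cV[R]_n -> R)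
    (q : V -> 'cV[R]_n) x :
  (\forall y \near x, linear (L y : 'cV[R]_n -> R^o)) ->
  (forall u, differentiable (fun y => L y u) x) ->
  differentiable q x -> differentiable (fun y => L y (q y)) x.
Proof.
move=> lin dL dq.
apply: (@near_eq_differentiable _ _
    (\sum_a ((fun y => q y a 0) * (fun y => L y (delta_mx a 0)))%R)).
  near=> y; rewrite fct_sumE.
  have ly : linear (L y : 'cV[R]_n -> R^o) by near: y.
  by rewrite (linear_expand (q y) ly).
apply: differentiable_sum => a; apply: differentiableM => //.
exact: differentiable_comp dq (differentiable_coord _ _ _).
Unshelve. all: by end_near. Qed.

Lemma differentiable_col {V : normedModType R} p (q : V -> 'cV[R]_p) y :
  (forall k, differentiable (fun z => q z k 0 : R) y) -> differentiable q y.
Proof.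
move=> dq; rewrite (_ : q = \sum_k (fun z => q z k 0 *: delta_mx k 0)).
  by apply: differentiable_sum => k; exact: differentiableZl.
by apply/funext => z; rewrite fct_sumE {1}[q z]cV_expand.
Qed.

Lemma smooth_on_cst {V W : normedModType R} (U : set V) (w : W) : smooth_on U (cst w).
Proof.
move=> k; elim: k w => [|k IH] w /=.
  by move=> x _; exact: cst_continuous.
split=> [x _|v]; first exact: differentiable_cst.
by rewrite (_ : 'D_v _ = cst 0)//; apply/funext => x; exact: derive_cst.
Qed.

End Differentiability.

Section ColumnBlocks.
Context {R : realType} {m n : nat}.

Lemma continuous_usubmx : continuous (usubmx : 'cV[R]_(m + n) -> 'cV[R]_m).
Proof.
move=> u A /nbhs_ballP[e /= e0 eA].
apply/nbhs_ballP; exists e => //= v [_ uv]; apply: eA; split => // i j.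
by apply: (le_lt_trans _ (uv (lshift n i) j)); rewrite !mxE.
Qed.

Lemma is_derive_usubmx (z A : 'cV[R]_(m + n)) : is_derive z A usubmx (usubmx A).
Proof.
apply: is_derive_mx => i j; rewrite mxE.
rewrite (_ : (fun y => _) = fun y : 'cV[R]_(m + n) => y (lshift n i) j).
  by apply: is_derive_coord; exact: is_derive_id.
by apply/funext => y; rewrite mxE.
Qed.

Lemma is_derive_dsubmx (z A : 'cV[R]_(m + n)) : is_derive z A dsubmx (dsubmx A).
Proof.
apply: is_derive_mx => i j; rewrite mxE.
rewrite (_ : (fun y => _) = fun y : 'cV[R]_(m + n) => y (rshift m i) j).
  by apply: is_derive_coord; exact: is_derive_id.
by apply/funext => y; rewrite mxE.
Qed.

Lemma is_derive_col_mx {E : normedModType R} (f : E -> 'cV[R]_m) (g : E -> 'cV[R]_n)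
    z A df dg : is_derive z A f df -> is_derive z A g dg ->
  is_derive z A (fun y => col_mx (f y) (g y)) (col_mx df dg).
Proof.
move=> dvf dvg; apply: is_derive_mx => i j; rewrite mxE.
rewrite (_ : (fun y => _) = fun y => match fintype.split i with
  inl a => f y a j | inr a => g y a j end); last by apply/funext => y; rewrite mxE.
by case: fintype.split => a; exact: is_derive_coord.
Qed.

End ColumnBlocks.

(** * Charts and curves *)

Section Charts.
Context {R : realType} {n : nat} {T : topologicalType} {C : charted R n T}.
Hypothesis M : smooth_manifold C.
Implicit Types (i j k : chart C) (p : T) (x u v : 'cV[R]_n).

Lemma chart_img_coord i p : chart_dom i p -> chart_img i (chart_coord i p).
Proof. by exists p. Qed.

Lemma chart_overlap_coord i j p : chart_dom i p -> chart_dom j p ->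
  chart_overlap i j (chart_coord i p).
Proof. by exists p. Qed.

Lemma chart_dom_pt i x : chart_img i x -> chart_dom i (chart_pt i x).
Proof. by case=> p ip <-; rewrite (mfd_coordK M). Qed.

Lemma chart_ptK i x : chart_img i x -> chart_coord i (chart_pt i x) = x.
Proof. by case=> p ip <-; rewrite (mfd_coordK M). Qed.

Lemma chart_overlapE i j :
  chart_overlap i j = chart_img i `&` [set x | chart_dom j (chart_pt i x)].
Proof.
apply/seteqP; split=> x /=.
  by case=> p [ip jp] <-; split; [exists p|rewrite /= (mfd_coordK M)].
by case=> ix jx; exists (chart_pt i x); [split => //; exact: chart_dom_pt|exact: chart_ptK].
Qed.

Lemma chart_overlap_open i j : open (chart_overlap i j).
Proof.
rewrite openE => x; rewrite chart_overlapE => -[ix jx].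
apply: filterI.
  by apply: open_nbhs_nbhs; split => //; exact: mfd_img_open M _.
apply: (mfd_pt_continuous M ix).
by apply: open_nbhs_nbhs; split => //; exact: mfd_dom_open M _.
Qed.

Lemma transition_coord i j p : chart_dom i p ->
  transition i j (chart_coord i p) = chart_coord j p.
Proof. by move=> ip; rewrite /transition /= (mfd_coordK M). Qed.

Lemma differentiable_transition i j x : chart_overlap i j x ->
  differentiable (transition i j) x.
Proof. by move=> ijx; have [/(_ x ijx)] := mfd_transition M i j 1%N. Qed.

Lemma differentiable_derive_transition i j v x : chart_overlap i j x ->
  differentiable ('D_v (transition i j)) x.
Proof. by move=> ijx; have [_ /(_ v)[/(_ x ijx)]] := mfd_transition M i j 2. Qed.

(** Cocycle rule for Jacobians: transitions compose on the overlap, which is open, so the identity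
    can be differentiated at [x]. It removes the distinguished charts through which components are
    defined. *)
Lemma derive_transition_comp i j k x v :
  chart_overlap i j x -> chart_overlap i k x ->
  'D_('D_v (transition i j) x) (transition j k) (transition i j x)
  = 'D_v (transition i k) x.
Proof.
move=> ijx ikx.
have jkx : chart_overlap j k (transition i j x).
  move: ijx ikx; rewrite !chart_overlapE => -[ix jx] [_ kx].
  split; first exact: chart_img_coord.
  by rewrite /= /transition /= (mfd_coordK M).
have dij := derivableP (@diff_derivable _ _ _ _ _ v (differentiable_transition ijx)).
have := is_derive_comp dij (differentiable_transition jkx).
move=> [_ <-]; apply: near_eq_derive.
have : nbhs x (chart_overlap i j).
  by apply: open_nbhs_nbhs; split => //; exact: chart_overlap_open.
apply: filterS => y; rewrite chart_overlapE => -[iy jy].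
by rewrite /= /transition /= (mfd_coordK M).
Qed.

Lemma derive_transition_id i x v : chart_img i x -> 'D_v (transition i i) x = v.
Proof.
move=> ix; rewrite -[RHS](derive_id x v); apply: near_eq_derive.
have : nbhs x (chart_img i).
  by apply: open_nbhs_nbhs; split => //; exact: mfd_img_open M _.
by apply: filterS => y iy; rewrite /transition /= chart_ptK.
Qed.

Lemma to_chart_pchart p v : to_chart (pchart C p) p v = v.
Proof. by apply: derive_transition_id; exact/chart_img_coord/(mfd_pchart M). Qed.

Lemma derive_transition_to_chart i j p v : chart_dom i p -> chart_dom j p ->
  'D_(to_chart i p v) (transition i j) (chart_coord i p) = to_chart j p v.
Proof.
move=> ip jp; have pp := mfd_pchart M p.
rewrite -(transition_coord i pp) /to_chart derive_transition_comp//.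
- exact: chart_overlap_coord.
- exact: chart_overlap_coord.
Qed.

Lemma of_chartE i p u : chart_dom i p ->
  of_chart i (chart_coord i p) u
  = 'D_u (transition i (pchart C p)) (chart_coord i p).
Proof. by move=> ip; rewrite /of_chart (mfd_coordK M). Qed.

Lemma to_chartK i p v : chart_dom i p ->
  of_chart i (chart_coord i p) (to_chart i p v) = v.
Proof.
move=> ip; rewrite of_chartE// derive_transition_to_chart ?to_chart_pchart//.
exact: mfd_pchart M _.
Qed.

Lemma chart_overlap_pchart i x : chart_img i x ->
  chart_overlap i (pchart C (chart_pt i x)) x.
Proof. by move=> ix; rewrite chart_overlapE; split => //; exact: mfd_pchart M _. Qed.

Lemma of_chart_linear i x : chart_img i x -> linear (of_chart i x).
Proof.
by move=> ix; apply/derive_linear/differentiable_transition/chart_overlap_pchart.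
Qed.

Lemma to_chart_linear i p : chart_dom i p -> linear (to_chart i p).
Proof.
move=> ip; apply/derive_linear/differentiable_transition/chart_overlap_coord => //.
exact: mfd_pchart M _.
Qed.

End Charts.

Lemma smooth_on_derive1 {R : realType} {W : normedModType R} (U : set R)
    (f : R -> W) (s : R) :
  smooth_on (U : set R^o) (f : R^o -> W) -> U s ->
  is_derive s 1 f (derive1 f s) /\ is_derive s 1 (derive1 f) (derive1 (derive1 f) s).
Proof.
move=> sf Us; have [df /(_ 1)[ddf _]] := sf 2.
split; rewrite derive1E; apply: derivableP; apply: diff_derivable.
  exact: (df s Us).
rewrite (_ : derive1 f = 'D_1 f); first exact: (ddf s Us).
by apply/funext => y; rewrite derive1E.
Qed.

(** * Curves and fields along them in an arbitrary chart *)

Section Curves.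
Context {R : realType} {n : nat} {T : topologicalType} {C : charted R n T}.
Hypothesis M : smooth_manifold C.
Variables (J : set R) (gam : R -> T).
Hypotheses (smooth_gam : smooth_curve C J gam).
Implicit Types (i j k : chart C) (s : R) (W : R -> 'cV[R]_n).

(** Allows one chart to be kept for all parameters near [s], while the distinguished chart of
    [gam r] varies with [r]. *)
Lemma curve_near_chart i s : J s -> chart_dom i (gam s) ->
  \forall r \near s, J r /\ chart_dom i (gam r).
Proof.
move=> Js is_; have [oJi _] := smooth_gam i.
by apply: (@open_nbhs_nbhs R); split.
Qed.

Lemma curve_is_derive i s : J s -> chart_dom i (gam s) ->
  is_derive s 1 (chart_coord i \o gam) (derive1 (chart_coord i \o gam) s).
Proof.
by move=> Js is_; have [] := smooth_on_derive1 (smooth_gam i).2 (conj Js is_).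
Qed.

Lemma curve_is_derive2 i s : J s -> chart_dom i (gam s) ->
  is_derive s 1 (derive1 (chart_coord i \o gam)) (derive1 (derive1 (chart_coord i \o gam)) s).
Proof.
by move=> Js is_; have [] := smooth_on_derive1 (smooth_gam i).2 (conj Js is_).
Qed.

Lemma derive_transition_curve k i s : J s ->
  chart_dom k (gam s) -> chart_dom i (gam s) ->
  'D_(derive1 (chart_coord k \o gam) s) (transition k i) (chart_coord k (gam s))
  = derive1 (chart_coord i \o gam) s.
Proof.
move=> Js ks is_; rewrite [RHS]derive1E.
have [] := is_derive_comp (curve_is_derive Js ks)
  (differentiable_transition M (chart_overlap_coord ks is_)).
move=> _ <-; apply: near_eq_derive.
near=> r; have [_ kr] : J r /\ chart_dom k (gam r).
  by near: r; exact: curve_near_chart.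
by rewrite /= transition_coord.
Unshelve. all: by end_near. Qed.

Lemma to_chart_velocity i s : J s -> chart_dom i (gam s) ->
  to_chart i (gam s) (velocity C gam s) = derive1 (chart_coord i \o gam) s.
Proof. by move=> Js is_; apply: derive_transition_curve => //; exact: mfd_pchart M _. Qed.

(** Components change by the Jacobian at the moving point, so their derivative picks up the Hessian
    of the transition: the failure of the ordinary derivative to be a tensor. *)
Lemma to_chart_is_derive k i W s dw : J s ->
  chart_dom k (gam s) -> chart_dom i (gam s) ->
  is_derive s 1 (fun r => to_chart k (gam r) (W r)) dw ->
  is_derive s 1 (fun r => to_chart i (gam r) (W r))
    ('D_(derive1 (chart_coord k \o gam) s)
       ('D_(to_chart k (gam s) (W s)) (transition k i)) (chart_coord k (gam s))
     + 'D_dw (transition k i) (chart_coord k (gam s))).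
Proof.
move=> Js ks is_ dvW.
have ck := curve_is_derive Js ks.
have := is_derive_derive_app (@chart_overlap_open _ _ _ _ M k i)
  (chart_overlap_coord ks is_ : chart_overlap k i ((chart_coord k \o gam) s))
  (@differentiable_transition _ _ _ _ M k i)
  (@differentiable_derive_transition _ _ _ _ M k i) _ ck dvW.
move=> /(_ _)H; apply: near_eq_is_derive (H _); last first.
  by apply/differentiable_continuous/derivable1_diffP; case: ck.
near=> r; apply: derive_transition_to_chart => //.
  by have [] : J r /\ chart_dom k (gam r) by near: r; exact: curve_near_chart.
by have [] : J r /\ chart_dom i (gam r) by near: r; exact: curve_near_chart.
Unshelve. all: by end_near. Qed.

(** The Hessian term from the change of chart is the inhomogeneous term of [conn_change], so the
    formula that defines the covariant derivative in the distinguished chart holds in every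
    chart. *)
Lemma to_chart_covariant_derivative (D : symbols C) i W s : connection D -> J s ->
  chart_dom i (gam s) ->
  derivable (fun r => to_chart (pchart C (gam s)) (gam r) (W r)) s 1 ->
  to_chart i (gam s) (covariant_derivative D gam W s)
  = derive1 (fun r => to_chart i (gam r) (W r)) s
    + christoffel D i (chart_coord i (gam s)) (derive1 (chart_coord i \o gam) s)
        (to_chart i (gam s) (W s)).
Proof.
move=> cD Js is_ /derivableP dvW; set k := pchart C (gam s) in dvW *.
have ks : chart_dom k (gam s) := mfd_pchart M _.
pose x := chart_coord k (gam s); pose tau := transition k i.
have dtau : differentiable tau x := differentiable_transition M (chart_overlap_coord ks is_).
have [_] := to_chart_is_derive Js ks is_ dvW.
rewrite -derive1E [to_chart k _ _]to_chart_pchart// -/x -/tau => ->.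
have : 'D_(christoffel D k x (velocity C gam s) (W s)) tau x
    = 'D_(velocity C gam s) ('D_(W s) tau) x
      + christoffel D i (chart_coord i (gam s))
          ('D_(velocity C gam s) tau x) ('D_(W s) tau x).
  rewrite -(transition_coord M i ks); apply: (conn_change cD).
  exact: chart_overlap_coord.
rewrite -(to_chart_velocity Js is_).
have -> : derive1 (chart_coord k \o gam) s = velocity C gam s by [].
have toE v : to_chart i (gam s) v = 'D_v tau x by [].
rewrite !toE addrAC => <-.
rewrite /covariant_derivative -/k -/x derive1E.
by rewrite !(deriveE _ dtau) linearD addrC.
Qed.

End Curves.

(** * Bundle charts of the tangent bundle *)

Section TangentBundle.
Context {R : realType} {n : nat} {T : topologicalType} {C : charted R n T}.
Hypothesis M : smooth_manifold C.
Implicit Types (i j k : chart C).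
Local Notation TB := (tangent_bundle C).

(** The fibre coordinate passes through two distinguished-chart conversions; by the cocycle rule
    only the Jacobian from [i] to [j] remains. *)
Lemma transition_tangent i j (y : 'cV[R]_(n + n)) : chart_overlap i j (usubmx y) ->
  transition (i : chart TB) (j : chart TB) y
  = col_mx (transition i j (usubmx y)) ('D_(dsubmx y) (transition i j) (usubmx y)).
Proof.
move=> ijy; rewrite /transition /=; congr col_mx.
rewrite /to_chart /of_chart -[chart_coord _ (chart_pt i _)]/(transition i _ (usubmx y)).
have iy : chart_img i (usubmx y) by move: ijy; rewrite chart_overlapE// => -[].
by rewrite derive_transition_comp//; exact: chart_overlap_pchart.
Qed.

Lemma is_derive_transition_tangent i j (z A : 'cV[R]_(n + n)) :
  chart_overlap i j (usubmx z) ->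
  is_derive z A (transition (i : chart TB) (j : chart TB))
    (col_mx ('D_(usubmx A) (transition i j) (usubmx z))
       ('D_(usubmx A) ('D_(dsubmx z) (transition i j)) (usubmx z)
        + 'D_(dsubmx A) (transition i j) (usubmx z))).
Proof.
move=> ijz.
have dtr x : chart_overlap i j x -> differentiable (transition i j) x.
  exact: differentiable_transition.
have near_z : \forall y \near z, chart_overlap i j (usubmx y).
  apply: continuous_usubmx; apply: open_nbhs_nbhs; split => //.
  exact: chart_overlap_open.
apply: near_eq_is_derive; first by near=> y; rewrite transition_tangent//; near: y.
apply: is_derive_col_mx.
  by apply: is_derive_comp (is_derive_usubmx z A) _; exact: dtr.
have := @is_derive_derive_app R 'cV[R]_(n + n) 'cV[R]_n n (transition i j)
  (chart_overlap i j) usubmx dsubmx z A _ _ _ ijz dtr _ _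
  (is_derive_usubmx z A) (is_derive_dsubmx z A).
apply; first exact: chart_overlap_open.
- by move=> v x; exact: differentiable_derive_transition.
- exact: continuous_usubmx.
Unshelve. all: by end_near. Qed.

Lemma derive_transition_tangent i j (x w a b : 'cV[R]_n) : chart_overlap i j x ->
  'D_(col_mx a b) (transition (i : chart TB) (j : chart TB)) (col_mx x w)
  = col_mx ('D_a (transition i j) x)
      ('D_a ('D_w (transition i j)) x + 'D_b (transition i j) x).
Proof.
move=> ijx; have := @is_derive_transition_tangent i j (col_mx x w) (col_mx a b).
by rewrite !col_mxKu !col_mxKd => /(_ ijx)[].
Qed.

Lemma of_chart_tangent i (y A : 'cV[R]_(n + n)) : chart_img i (usubmx y) ->
  let tau := transition i (pchart C (chart_pt i (usubmx y))) in
  of_chart (i : chart TB) y A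
  = col_mx ('D_(usubmx A) tau (usubmx y))
      ('D_(usubmx A) ('D_(dsubmx y) tau) (usubmx y) + 'D_(dsubmx A) tau (usubmx y)).
Proof.
by move=> /(chart_overlap_pchart M)/(is_derive_transition_tangent A)[].
Qed.

Section Curves.
Variables (J : set R) (gam : R -> T) (xi : R -> 'cV[R]_n).
Hypotheses (smooth_gam : smooth_curve C J gam) (smooth_xi : smooth_along C J gam xi).
Implicit Types (s t : R).
Local Notation Gam := (fun s => (gam s, xi s)).
Local Notation base i := (chart_coord i \o gam).
Local Notation fibre i := (fun s => to_chart i (gam s) (xi s)).

Lemma fibre_is_derive i s : J s -> chart_dom i (gam s) ->
  is_derive s 1 (fibre i) (derive1 (fibre i) s).
Proof. 
move=> Js is_.
have H := smooth_on_derive1 (smooth_xi i) (conj Js is_).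
exact: (proj1 H).
 Qed.

Lemma fibre_is_derive2 i s : J s -> chart_dom i (gam s) ->
  is_derive s 1 (derive1 (fibre i)) (derive1 (derive1 (fibre i)) s).
Proof. 
move=> Js is_.
have H := smooth_on_derive1 (smooth_xi i) (conj Js is_).
exact: (proj2 H).
 Qed.

(** The acceleration at [t] differentiates velocities at nearby parameters, each stored in its own
    distinguished chart. The Hessian in the lower block is the one already met when a field along
    the curve changes chart. *)
Lemma to_chart_velocity_tangent i s : J s -> chart_dom i (gam s) ->
  to_chart (i : chart TB) (Gam s) (velocity TB Gam s)
  = col_mx (derive1 (base i) s) (derive1 (fibre i) s).
Proof.
move=> Js is_; set k := pchart C (gam s).
have ks : chart_dom k (gam s) := mfd_pchart M _.
have velE : velocity TB Gam s = col_mx (derive1 (base k) s) (derive1 (fibre k) s).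
  rewrite /velocity derive1E.
  by have [] := is_derive_col_mx (curve_is_derive smooth_gam Js ks) (fibre_is_derive Js ks).
have ovl : chart_overlap k i (chart_coord k (gam s)) by exact: chart_overlap_coord.
rewrite velE.
have toE v : to_chart (i : chart TB) (Gam s) v = 'D_v (transition (k : chart TB) i)
  (col_mx (chart_coord k (gam s)) (to_chart k (gam s) (xi s))) by [].
rewrite toE.
apply: (etrans (derive_transition_tangent _ _ _ ovl)).
apply: f_equal2.
  exact: (derive_transition_curve M smooth_gam Js ks is_).
rewrite [RHS]derive1E.
by rewrite (@derive_val _ _ _ _ _ _ _
  (to_chart_is_derive M smooth_gam Js ks is_ (fibre_is_derive Js ks))).
Qed.

Lemma covariant_derivative_tangent (Dt : symbols TB) t (i := pchart C (gam t)) : J t ->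
  velocity TB Gam t = col_mx (derive1 (base i) t) (derive1 (fibre i) t) /\
  covariant_derivative Dt Gam (velocity TB Gam) t
  = col_mx (derive1 (derive1 (base i)) t) (derive1 (derive1 (fibre i)) t)
    + christoffel Dt i (col_mx (base i t) (fibre i t))
        (velocity TB Gam t) (velocity TB Gam t).
Proof.
move=> Jt; have it : chart_dom i (gam t) := mfd_pchart M _.
split.
  rewrite /velocity derive1E.
  by have [] := is_derive_col_mx (curve_is_derive smooth_gam Jt it) (fibre_is_derive Jt it).
rewrite /covariant_derivative; congr (_ + _).
have [_ <-] := is_derive_col_mx (curve_is_derive2 smooth_gam Jt it) (fibre_is_derive2 Jt it).
rewrite derive1E; apply: near_eq_derive.
apply: filterS (curve_near_chart smooth_gam Jt it) => s [Js is_].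
exact: to_chart_velocity_tangent.
Qed.

End Curves.

Lemma endo_inK (phi : T -> 'cV[R]_n -> 'cV[R]_n) i x u : chart_img i x ->
  of_chart i x (endo_in phi i x u) = phi (chart_pt i x) (of_chart i x u).
Proof.
move=> ix; rewrite /endo_in -{1}(chart_ptK M ix) to_chartK//.
exact: chart_dom_pt.
Qed.

(** Metric compatibility differentiates the metric over a neighbourhood in one chart, but the metric
    is defined in distinguished charts. The two agree because b + Gamma(a, w) transforms as a
    tangent vector, the Hessian cancelling by [conn_change]. *)
Lemma phi_sasaki_in (D : symbols C) g phi i (y A B : 'cV[R]_(n + n)) :
  connection D -> chart_img i (usubmx y) ->
  form_in (phi_sasaki D phi g) (i : chart TB) y A B
  = form_in g i (usubmx y) (usubmx A) (usubmx B)
    + form_in g i (usubmx y)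
        (dsubmx A + christoffel D i (usubmx y) (usubmx A) (dsubmx y))
        (endo_in phi i (usubmx y)
          (dsubmx B + christoffel D i (usubmx y) (usubmx B) (dsubmx y))).
Proof.
move=> cD iy.
have hE E : hpart (of_chart (i : chart TB) y E) = of_chart i (usubmx y) (usubmx E).
  by rewrite of_chart_tangent// /hpart col_mxKu.
have vE E : vpart D (chart_pt i (usubmx y), of_chart i (usubmx y) (dsubmx y))
    (of_chart (i : chart TB) y E)
    = of_chart i (usubmx y) (dsubmx E + christoffel D i (usubmx y) (usubmx E) (dsubmx y)).
  rewrite /vpart of_chart_tangent//= col_mxKu col_mxKd.
  set k := pchart C _.
  have ovl : chart_overlap i k (usubmx y) by exact: chart_overlap_pchart.
  have dtau := differentiable_transition M ovl.
  have ofE v : of_chart i (usubmx y) v = 'D_v (transition i k) (usubmx y) by [].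
  rewrite !ofE [RHS](deriveE _ dtau) linearD -!(deriveE _ dtau).
  by rewrite [X in _ = _ + X](conn_change cD)// addrAC addrC.
set p := chart_pt i (usubmx y) in vE *.
have fE u v : form_in g i (usubmx y) u v
    = g p (of_chart i (usubmx y) u) (of_chart i (usubmx y) v) by [].
by rewrite !fE (endo_inK _ _ iy) -!hE -!vE.
Qed.

End TangentBundle.

(** * Connections on an open set of coordinates *)

Section LocalConnection.
Context {R : realType} {n : nat}.
Local Notation vec := 'cV[R]_n.
Variables (U : set vec) (G : vec -> vec -> vec -> vec).
Hypotheses (oU : open U)
  (Gr : forall x u, linear (G x u))
  (Gsym : forall x u v, U x -> G x u v = G x v u)
  (dG : forall x u v, U x -> differentiable (fun y => G y u v) x).
Implicit Types (x a b c u v w : vec) (k : vec -> vec -> vec -> R).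

Let nearU x : U x -> \forall y \near x, U y.
Proof. by move=> Ux; exact: open_nbhs_nbhs. Qed.

Lemma connectionDr x u v w : G x u (v + w) = G x u v + G x u w.
Proof. by have := Gr x u 1 v w; rewrite !scale1r. Qed.

(** The curvature R(a, b)c on constant fields, whose brackets vanish. *)
Definition local_curvature x a b c : vec :=
  'D_a (fun y => G y b c) x - 'D_b (fun y => G y a c) x
  + G x a (G x b c) - G x b (G x a c).

(** One interface for g and for g(., phi .), so that skewness of the curvature is proved once for
    both. *)
Record parallel_form k : Prop := {
  parallel_linearl : forall x v, U x -> linear (k x ^~ v : vec -> R^o);
  parallel_linearr : forall x u, U x -> linear (k x u : vec -> R^o);
  parallel_differentiable : forall x u v, U x -> differentiable (fun y => k y u v) x;
  parallel_derive : forall x a u v, U x ->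
    'D_a (fun y => k y u v) x = k x (G x a u) v + k x u (G x a v)
}.

(** Symmetry of [G] matches the terms of the cyclic sum in cancelling pairs; it holds throughout the
    open set, so it also passes to the derivatives. *)
Lemma local_bianchi x a b c : U x ->
  local_curvature x a b c + local_curvature x b c a + local_curvature x c a b = 0.
Proof.
move=> Ux.
have dsym u v w : 'D_u (fun y => G y v w) x = 'D_u (fun y => G y w v) x.
  apply: near_eq_derive; apply: filterS (nearU Ux) => y Uy; exact: Gsym.
rewrite /local_curvature (dsym a c b) (dsym b a c) (dsym c b a).
rewrite (Gsym c b Ux) (Gsym a c Ux) (Gsym b a Ux).
have E (d1 d2 d3 e1 e2 e3 : vec) : (d1 - d2 + e1 - e2) + (d2 - d3 + e2 - e3)
    + (d3 - d1 + e3 - e1) = 0.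
  by apply/matrixP => i j; rewrite !mxE; ring.
exact: E.
Qed.

Section ParallelForm.
Variable k : vec -> vec -> vec -> R.
Hypothesis pk : parallel_form k.

Lemma parallelDl x u v w : U x -> k x (u + v) w = k x u w + k x v w.
Proof.
by move=> Ux; have := parallel_linearl pk w Ux 1 u v; rewrite !scale1r.
Qed.

Lemma parallelDr x u v w : U x -> k x u (v + w) = k x u v + k x u w.
Proof.
by move=> Ux; have := parallel_linearr pk u Ux 1 v w; rewrite !scale1r.
Qed.

Lemma parallel0l x w : U x -> k x 0 w = 0.
Proof. by move=> Ux; have := parallelDl 0 0 w Ux; rewrite addr0 => E; lra. Qed.

Lemma parallel0r x w : U x -> k x w 0 = 0.
Proof. by move=> Ux; have := parallelDr w 0 0 Ux; rewrite addr0 => E; lra. Qed.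

Lemma parallelNl x u w : U x -> k x (- u) w = - k x u w.
Proof.
by move=> Ux; have := parallelDl u (- u) w Ux; rewrite subrr parallel0l// => E; lra.
Qed.

Lemma parallelNr x u w : U x -> k x w (- u) = - k x w u.
Proof.
by move=> Ux; have := parallelDr w u (- u) Ux; rewrite subrr parallel0r// => E; lra.
Qed.

(** Leibniz rule over a map [p] into the base: parallelism converts the derivative of [k] into
    corrections of its arguments. It serves on the base with [p] the identity and on the total space
    with [p] the projection. *)
Lemma parallel_is_derive {E : normedModType R} (z A : E) (p q r : E -> vec) dp dq dr :
  U (p z) -> {for z, continuous p} ->
  is_derive z A p dp -> is_derive z A q dq -> is_derive z A r dr ->
  is_derive z A (fun y => k (p y) (q y) (r y))
    (k (p z) (G (p z) dp (q z) + dq) (r z) + k (p z) (q z) (G (p z) dp (r z) + dr)).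
Proof.
move=> Up cp dvp dvq dvr.
have near_p : \forall y \near z, U (p y) by apply: cp; exact: nearU.
have dk u v : is_derive z A (fun y => k (p y) u v)
    (k (p z) (G (p z) dp u) v + k (p z) u (G (p z) dp v)).
  rewrite -(parallel_derive pk)//; apply: (is_derive_comp dvp).
  exact: parallel_differentiable pk _ _ _ Up.
have := @is_derive_bilin_app R E R^o n n (fun y => k (p y)) q r z A dq dr _ _ _
  (dk (q z) (r z)) _ dvq dvr.
move=> H; apply: is_derive_eq; first apply: H.
- by apply: filterS near_p => y Uy v s t w; exact: (parallel_linearl pk v Uy s t w).
- by apply: filterS near_p => y Uy v s t w; exact: (parallel_linearr pk v Uy s t w).
- by move=> u v; have [] := dk u v.
- by rewrite parallelDl// parallelDr//=; ring.
Qed.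

(** The second derivatives of k(u, v) along [a] and [b] commute. Written through the connection,
    their difference is the curvature acting as a derivation on the two arguments. *)
Lemma parallel_curvature_skew x a b u v : U x ->
  k x (local_curvature x a b u) v + k x u (local_curvature x a b v) = 0.
Proof.
move=> Ux; pose f y := k y u v.
have Df c : \forall y \near x, 'D_c f y = k y (G y c u) v + k y u (G y c v).
  by apply: filterS (nearU Ux) => y Uy; exact: parallel_derive.
have df c : \forall y \near x, derivable f y c.
  apply: filterS (nearU Ux) => y Uy; apply: diff_derivable.
  exact: parallel_differentiable.
have ddf c : differentiable ('D_c f) x.
  apply: near_eq_differentiable; first by apply: filterS (Df c) => y ->.
  apply: differentiableD.
    apply: (@differentiable_lin_app _ _ _ (fun y w => k y w v)).
    - by apply: filterS (nearU Ux) => y Uy; exact: parallel_linearl.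
    - by move=> w; exact: parallel_differentiable.
    - exact: dG.
  apply: (@differentiable_lin_app _ _ _ (fun y w => k y u w)).
  - by apply: filterS (nearU Ux) => y Uy; exact: parallel_linearr.
  - by move=> w; exact: parallel_differentiable.
  - exact: dG.
have dvid c : is_derive x c id c by exact: is_derive_id.
have dvG c d w : is_derive x c (fun y => G y d w) ('D_c (fun y => G y d w) x).
  by apply: derivableP; apply: diff_derivable; exact: dG.
have DDf c d : 'D_c ('D_d f) x
    = k x (G x c (G x d u) + 'D_c (fun y => G y d u) x) v + k x (G x d u) (G x c v + 0)
    + (k x (G x c u + 0) (G x d v)
       + k x u (G x c (G x d v) + 'D_c (fun y => G y d v) x)).
  rewrite (near_eq_derive _ (Df d)).
  have dcst w : is_derive x c (cst w : vec -> vec) 0 by exact: is_derive_cst.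
  have H1 := parallel_is_derive Ux (fun A => id) (dvid c) (dvG c d u) (dcst v).
  have H2 := parallel_is_derive Ux (fun A => id) (dvid c) (dcst u) (dvG c d v).
  have H := is_deriveD H1 H2.
  exact: (@derive_val _ _ _ _ _ _ _ H).
have := derive_comm (df a) (df b) (ddf a) (ddf b).
rewrite !DDf /local_curvature !addr0.
(* [t] and [t'] are the mixed products, one argument differentiated along each direction; exchanging
   the directions swaps them, so they cancel. *)
have L (p q r s p' q' r' s' : vec) (t t' : R) :
    k x (p + q) v + t + (t' + k x u (p' + q'))
    = k x (r + s) v + t' + (t + k x u (r' + s')) ->
    k x (s - q + r - p) v + k x u (s' - q' + r' - p') = 0.
  by rewrite !(parallelDl, parallelDr, parallelNl, parallelNr)// => *; lra.
exact: L.
Qed.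

Lemma curvature_pair_symmetry x a b c d : U x ->
  (forall u v, k x u v = k x v u) ->
  k x (local_curvature x a b c) d = k x (local_curvature x c d a) b.
Proof.
move=> Ux ksym; pose r a b c d := k x (local_curvature x a b c) d.
have r12 p q s t : r p q s t = - r q p s t.
  rewrite /r -parallelNl//; congr (k x _ t).
  have E (d1 d2 e1 e2 : vec) : d1 - d2 + e1 - e2 = - (d2 - d1 + e2 - e1).
    by apply/matrixP => i j; rewrite !mxE; ring.
  exact: E.
have r34 p q s t : r p q s t = - r p q t s.
  have := parallel_curvature_skew p q s t Ux.
  by rewrite [X in _ + X]ksym => /eqP; rewrite addr_eq0 => /eqP.
have r0 p q s t : r p q s t + r q s p t + r s p q t = 0.
  rewrite /r -!parallelDl// local_bianchi//.
  exact: parallel0l.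
(* Modulo the two skew symmetries, [e1 + e2 - e3 - e4] is twice the difference of the two sides. *)
have e1 := r0 a b c d; have e2 := r0 b c d a; have e3 := r0 c d a b.
have e4 := r0 d a b c.
rewrite -/(r a b c d) -/(r c d a b).
move: (r34 b c a d) (r34 c a b d) (r34 a b c d) (r34 c d b a) (r34 d b c a)
  (r34 b c d a) (r34 d a c b) (r34 a c d b) (r34 c d a b) (r34 a b d c) (r34 b d a c)
  (r34 d a b c) (r12 a c b d) (r12 b d a c) (r12 a c d b) (r12 d b c a) (r12 d a b c).
by move=> *; lra.
Qed.

End ParallelForm.

(** * The metric on the total space and its geodesic spray *)

Section TotalSpace.
Local Notation vec2 := 'cV[R]_(n + n).
Variables g h : vec -> vec -> vec -> R.
Hypotheses (pg : parallel_form g) (ph : parallel_form h).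
Implicit Types (z A B : vec2).

Definition vertical z A : vec := dsubmx A + G (usubmx z) (usubmx A) (dsubmx z).

(* The connection on the fibres pulled back to the total space, applied along A
   to the vertical part of the constant field B. *)
Definition nabla_vertical z A B : vec :=
  G (usubmx z) (usubmx A) (vertical z B)
  + ('D_(usubmx A) (fun y => G y (usubmx B) (dsubmx z)) (usubmx z)
     + G (usubmx z) (usubmx B) (dsubmx A)).

Definition total_form z A B : R :=
  g (usubmx z) (usubmx A) (usubmx B) + h (usubmx z) (vertical z A) (vertical z B).

Lemma vertical_is_derive z A B : U (usubmx z) ->
  is_derive z A (vertical ^~ B)
    ('D_(usubmx A) (fun y => G y (usubmx B) (dsubmx z)) (usubmx z)
     + G (usubmx z) (usubmx B) (dsubmx A)).
Proof.
move=> Uz.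
have dGz w : is_derive z A (fun y => G (usubmx y) (usubmx B) w)
    ('D_(usubmx A) (fun y => G y (usubmx B) w) (usubmx z)).
  by apply: (is_derive_comp (is_derive_usubmx z A)); exact: dG.
have := @is_derive_lin_app R vec2 vec n (fun y => G (usubmx y) (usubmx B)) dsubmx z A
  _ _ _ (dGz (dsubmx z)) (fun w => @ex_derive _ _ _ _ _ _ _ (dGz w)) (is_derive_dsubmx z A).
have lin : \forall y \near z, linear (G (usubmx y) (usubmx B)).
  by near=> y; exact: Gr.
move=> /(_ lin)H.
have := is_deriveD (is_derive_cst (dsubmx B) z A) H.
by rewrite add0r.
Unshelve. all: by end_near. Qed.

(** Structure equation: for constant fields this is the exterior covariant derivative of the
    vertical projection, and the curvature applied to the fibre point. It is how curvature enters
    the geodesic equation. *)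
Lemma nabla_vertical_sub z A B : U (usubmx z) ->
  nabla_vertical z A B - nabla_vertical z B A
  = local_curvature (usubmx z) (usubmx A) (usubmx B) (dsubmx z).
Proof.
move=> Uz; rewrite /nabla_vertical /vertical !connectionDr /local_curvature.
rewrite (Gsym (usubmx B) (dsubmx A) Uz) (Gsym (usubmx A) (dsubmx B) Uz).
have E (e1 e2 e3 e4 d1 d2 : vec) : e1 + e2 + (d1 + e3) - (e3 + e4 + (d2 + e1))
    = d1 - d2 + e2 - e4.
  by apply/matrixP => i j; rewrite !mxE; ring.
rewrite (Gsym (dsubmx A) (usubmx B) Uz) (Gsym (dsubmx B) (usubmx A) Uz).
exact: E.
Qed.

Lemma total_form_derive z A B C : U (usubmx z) ->
  'D_A (fun y => total_form y B C) z
  = g (usubmx z) (G (usubmx z) (usubmx A) (usubmx B)) (usubmx C)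
    + g (usubmx z) (usubmx B) (G (usubmx z) (usubmx A) (usubmx C))
    + (h (usubmx z) (nabla_vertical z A B) (vertical z C)
       + h (usubmx z) (vertical z B) (nabla_vertical z A C)).
Proof.
move=> Uz.
have dcst u : is_derive z A (cst u : vec2 -> vec) 0 by exact: is_derive_cst.
have H1 := parallel_is_derive pg Uz (@continuous_usubmx _ _ _ z)
  (is_derive_usubmx z A) (dcst (usubmx B)) (dcst (usubmx C)).
have H2 := parallel_is_derive ph Uz (@continuous_usubmx _ _ _ z)
  (is_derive_usubmx z A) (vertical_is_derive A B Uz) (vertical_is_derive A C Uz).
have H := is_deriveD H1 H2.
by apply: (etrans (@derive_val _ _ _ _ _ _ _ H)); rewrite /= !addr0.
Qed.

Variable K : vec2 -> vec2 -> vec2.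

(** Symmetry of [K] eliminates G(A, K(A, B)) and leaves G(K(A, A), B) = A G(A, B) - (1/2) B G(A, A).
    The h-part contains nabla_A vert B - nabla_B vert A, hence the curvature. *)
Lemma total_form_koszul z A B : U (usubmx z) ->
  (forall u v, g (usubmx z) u v = g (usubmx z) v u) ->
  (forall u v, h (usubmx z) u v = h (usubmx z) v u) ->
  K A B = K B A ->
  (forall X Y Z, 'D_X (fun y => total_form y Y Z) z
    = total_form z (K X Y) Z + total_form z Y (K X Z)) ->
  total_form z (K A A) B
  = g (usubmx z) (G (usubmx z) (usubmx A) (usubmx A)) (usubmx B)
    + h (usubmx z) (nabla_vertical z A A) (vertical z B)
    + h (usubmx z) (vertical z A)
        (local_curvature (usubmx z) (usubmx A) (usubmx B) (dsubmx z)).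
Proof.
move=> Uz gsym hsym Ksym Kmetric.
have EA := Kmetric A A B; have EB := Kmetric B A A.
have tsym X Y : total_form z X Y = total_form z Y X.
  by rewrite /total_form gsym hsym.
rewrite !total_form_derive// in EA EB.
rewrite -Ksym [X in _ = X + _]tsym in EB.
rewrite (gsym (G _ _ _)) (hsym (nabla_vertical _ _ _)) (Gsym (usubmx B) _ Uz) in EB.
rewrite -nabla_vertical_sub// (parallelDr ph)// (parallelNr ph)//.
by lra.
Qed.

Lemma total_form_spray z A (phi : vec -> vec) : U (usubmx z) ->
  (forall u v, g (usubmx z) u v = g (usubmx z) v u) ->
  (forall u, u != 0 -> 0 < g (usubmx z) u u) ->
  (forall u v, h (usubmx z) u v = g (usubmx z) u (phi v)) ->
  (forall u v, g (usubmx z) (phi u) v = g (usubmx z) u (phi v)) ->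
  involutive phi ->
  (forall B, K A B = K B A) ->
  (forall X Y Z, 'D_X (fun y => total_form y Y Z) z
    = total_form z (K X Y) Z + total_form z Y (K X Z)) ->
  usubmx (K A A) = G (usubmx z) (usubmx A) (usubmx A)
     - local_curvature (usubmx z) (vertical z A) (phi (dsubmx z)) (usubmx A)
  /\ vertical z (K A A) = nabla_vertical z A A.
Proof.
move=> Uz gsym gpos hE phisym phiK Ksym Kmetric.
have hsym u v : h (usubmx z) u v = h (usubmx z) v u by rewrite !hE -phisym gsym.
set x := usubmx z in Uz gsym gpos hE phisym hsym *.
set a := usubmx A; set w := dsubmx z; set al := vertical z A.
set ka := usubmx (K A A) - (G x a a - local_curvature x al (phi w) a).
set la := vertical z (K A A) - nabla_vertical z A A.
suff [ka0 la0] : ka = 0 /\ la = 0 by split; apply/eqP; rewrite -subr_eq0; apply/eqP.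
have E B : g x ka (usubmx B) + h x la (vertical z B) = 0.
  have := total_form_koszul Uz gsym hsym (Ksym B) Kmetric.
  have := parallel_curvature_skew ph a (usubmx B) al w Uz.
  rewrite [h x (local_curvature _ _ _ _) _]hE.
  rewrite (curvature_pair_symmetry pg _ _ _ _ Uz gsym).
  have L (u1 u2 u3 v1 v2 b1 b2 : vec) (s : R) : g x u3 b1 + s = 0 ->
      g x u1 b1 + h x v1 b2 = g x u2 b1 + h x v2 b2 + s ->
      g x (u1 - (u2 - u3)) b1 + h x (v1 - v2) b2 = 0.
    rewrite opprB !(parallelDl pg, parallelDl ph, parallelNl pg, parallelNl ph)//.
    by move=> *; lra.
  exact: L.
(* The test vector has horizontal part [ka] and, after the Christoffel correction cancels, vertical
   part [phi la]. As h(la, phi la) = g(la, la), two nonnegative terms sum to zero. *)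
have := E (col_mx ka (phi la - G x ka w)).
rewrite /vertical col_mxKu col_mxKd -/x -/w subrK hE phiK => E0.
have gge0 u : 0 <= g x u u.
  have [->|/gpos/ltW//] := eqVneq u 0.
  by rewrite (parallel0l pg).
have g0 u : g x u u = 0 -> u = 0.
  by move=> gu; apply/eqP; apply: contraTT isT => /gpos; rewrite gu ltxx.
have := gge0 ka; have := gge0 la => h1 h2.
by split; apply: g0; lra.
Qed.

End TotalSpace.
End LocalConnection.

(** * Levi-Civita connections and geodesics *)

Section Christoffel.
Context {R : realType} {n : nat} {T : topologicalType} {C : charted R n T}.
Variable D : symbols C.
Implicit Types (i : chart C) (x u v : 'cV[R]_n).

Lemma christoffel_linearl i x v : linear (christoffel D i x ^~ v).
Proof.
move=> c u w; apply/colP => k; rewrite !mxE mulr_sumr -big_split/=.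
apply: eq_bigr => a _; rewrite mulr_sumr -big_split/=.
by apply: eq_bigr => b _; rewrite !mxE; ring.
Qed.

Lemma christoffel_linearr i x u : linear (christoffel D i x u).
Proof.
move=> c v w; apply/colP => k; rewrite !mxE mulr_sumr -big_split/=.
apply: eq_bigr => a _; rewrite mulr_sumr -big_split/=.
by apply: eq_bigr => b _; rewrite !mxE; ring.
Qed.

Lemma christoffel_differentiable i x u v : connection D -> chart_img i x ->
  differentiable (fun y => christoffel D i y u v) x.
Proof.
move=> cD ix; apply: differentiable_col => k.
rewrite (_ : (fun y => _) = \sum_a \sum_b
    ((u a 0 * v b 0) \*: (D i k a b : 'cV[R]_n -> R^o))); last first.
  apply/funext => y; rewrite mxE fct_sumE; apply: eq_bigr => a _.
  rewrite fct_sumE; apply: eq_bigr => b _.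
  by rewrite -mulrA mulrC.
apply: differentiable_sum => a; apply: differentiable_sum => b.
apply: differentiableZ; have [+ _] := conn_smooth cD i k a b 1%N; exact.
Qed.

Lemma nabla_cst i u v x : nabla D i (cst u) (cst v) x = christoffel D i x u v.
Proof. by rewrite /nabla derive_cst add0r. Qed.

Lemma christoffel_sym i x u v : torsion_free D -> chart_img i x ->
  christoffel D i x u v = christoffel D i x v u.
Proof.
move=> tD ix; apply/eqP; rewrite -subr_eq0 -!nabla_cst tD//; try exact: smooth_on_cst.
by rewrite /bracket !derive_cst subrr.
Qed.

Lemma metric_connection_cst g i x a u v : metric_connection D g -> chart_img i x ->
  'D_a (fun y => form_in g i y u v : R^o) x
  = form_in g i x (christoffel D i x a u) v + form_in g i x u (christoffel D i x a v).
Proof.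
move=> mD ix; rewrite -!nabla_cst.
by rewrite -(mD i (cst a) (cst u) (cst v))//; exact: smooth_on_cst.
Qed.

Lemma curvature_field_cst i x u v w :
  curvature_field D i (cst u) (cst v) (cst w) x
  = local_curvature (christoffel D i) x u v w.
Proof.
have nE a b : nabla D i (cst a) (cst b) = fun y => christoffel D i y a b.
  by apply/funext => y; rewrite nabla_cst.
rewrite /curvature_field !nE {1 2}/nabla {1}/nabla /bracket !derive_cst subrr.
rewrite christoffel0 addr0 subr0 /local_curvature.
by rewrite opprD addrA; congr (_ - _); rewrite addrAC.
Qed.

End Christoffel.

(** * The metric and its twist by phi as parallel forms *)

Section ParallelForms.
Context {R : realType} {n : nat} {T : topologicalType} {C : charted R n T}.
Variables (D : symbols C) (g : T -> 'cV[R]_n -> 'cV[R]_n -> R)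
  (phi : T -> 'cV[R]_n -> 'cV[R]_n).
Hypotheses (M : smooth_manifold C) (rg : riemannian C g) (lcD : levi_civita D g).
Hypotheses (tphi : tensor11 C phi) (pphi : parallel11 D phi).
Implicit Types (i : chart C) (x u v : 'cV[R]_n).

Lemma riemannian_linearr p u : linear (g p u : 'cV[R]_n -> R^o).
Proof. by move=> c v w; rewrite !(riem_sym rg p u); exact: (riem_linear rg p u c v w). Qed.

Lemma form_in_linearl i x v : chart_img i x ->
  linear ((form_in g i x) ^~ v : 'cV[R]_n -> R^o).
Proof.
move=> ix c u w; rewrite /form_in (of_chart_linear M ix).
exact: (riem_linear rg).
Qed.

Lemma form_in_linearr i x u : chart_img i x ->
  linear (form_in g i x u : 'cV[R]_n -> R^o).
Proof.
move=> ix c v w; rewrite /form_in (of_chart_linear M ix).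
exact: riemannian_linearr.
Qed.

Lemma form_in_differentiable i x u v : chart_img i x ->
  differentiable (fun y => form_in g i y u v : R) x.
Proof. by move=> ix; have [+ _] := riem_smooth rg i u v 1%N; exact. Qed.

Lemma endo_in_linear i x : chart_img i x -> linear (endo_in phi i x).
Proof.
move=> ix c u v; rewrite /endo_in (of_chart_linear M ix) (tensor11_linear tphi).
by rewrite (to_chart_linear M (chart_dom_pt M ix)).
Qed.

Lemma endo_in_differentiable i x v : chart_img i x ->
  differentiable (endo_in phi i ^~ v) x.
Proof. by move=> ix; have [+ _] := tensor11_smooth tphi i v 1%N; exact. Qed.

Lemma parallel_form_metric i :
  parallel_form (chart_img i) (christoffel D i) (form_in g i).
Proof.
split.
- by move=> x v; exact: form_in_linearl.
- by move=> x u; exact: form_in_linearr.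
- by move=> x u v; exact: form_in_differentiable.
- by move=> x a u v; exact: metric_connection_cst (lc_metric lcD).
Qed.

Lemma parallel_form_twisted i :
  parallel_form (chart_img i) (christoffel D i)
    (fun x u v => form_in g i x u (endo_in phi i x v)).
Proof.
split.
- by move=> x v; exact: form_in_linearl.
- by move=> x u ix c v w; rewrite (endo_in_linear ix) (form_in_linearr _ ix).
- move=> x u v ix; apply: (@differentiable_lin_app _ _ _ (fun y => form_in g i y u)).
  + have : nbhs x (chart_img i).
      by apply: open_nbhs_nbhs; split => //; exact: mfd_img_open M _.
    by apply: filterS => y iy; exact: form_in_linearr.
  + by move=> w; exact: form_in_differentiable.
  + exact: endo_in_differentiable.
(* Metric compatibility is applied to the nonconstant field phi v; nabla phi = 0 identifies its
   covariant derivative with phi of that of v. *)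
- move=> x a u v ix; rewrite -2!nabla_cst.
  have scst w : smooth_on (chart_img i) (cst w : 'cV[R]_n -> 'cV[R]_n).
    exact: smooth_on_cst.
  rewrite -(pphi (scst a) (scst v) ix).
  exact: (lc_metric lcD (scst a) (scst u) (tensor11_smooth tphi i v) ix).
Qed.

End ParallelForms.

(** * Accelerations on the base and on the tangent bundle *)

Section Geodesics.
Context {R : realType} {n : nat} {T : topologicalType} {C : charted R n T}.
Variables (D : symbols C) (g : T -> 'cV[R]_n -> 'cV[R]_n -> R)
  (phi F : T -> 'cV[R]_n -> 'cV[R]_n) (Dt : symbols (tangent_bundle C)).
Hypotheses (M : smooth_manifold C) (rg : riemannian C g) (lcD : levi_civita D g).
Hypotheses (tphi : tensor11 C phi) (pphi : parallel11 D phi).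
Hypotheses (phiK : forall p u, phi p (phi p u) = u)
  (gphi : forall p u v, g p (phi p u) v = g p u (phi p v)).
Hypothesis lcDt : levi_civita Dt (phi_sasaki D phi g).
Local Notation vec := 'cV[R]_n.
Local Notation vec2 := 'cV[R]_(n + n).
Local Notation TB := (tangent_bundle C).

Let cD : connection D := lc_connection lcD.

Lemma of_chart_pchart p u :
  of_chart (pchart C p) (chart_coord (pchart C p) p) u = u.
Proof.
by rewrite -{1}(to_chart_pchart M p u) to_chartK//; exact: mfd_pchart M _.
Qed.

Lemma form_in_pchart p u v :
  form_in g (pchart C p) (chart_coord (pchart C p) p) u v = g p u v.
Proof.
rewrite /form_in !of_chart_pchart (mfd_coordK M)//; exact: mfd_pchart M _.
Qed.

Lemma endo_in_pchart p u :
  endo_in phi (pchart C p) (chart_coord (pchart C p) p) u = phi p u.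
Proof.
rewrite /endo_in of_chart_pchart (mfd_coordK M) ?to_chart_pchart//.
exact: mfd_pchart M _.
Qed.

(** At [p] the distinguished chart makes the local forms coincide with [g] and [phi], so positivity,
    purity and the involution can be used pointwise. The compatibility identity concerns a whole
    neighbourhood of [z]. *)
Lemma christoffel_spray p (v : vec) (A : vec2) (i := pchart C p)
    (x := chart_coord (pchart C p) p) (z := col_mx x v)
    (G := christoffel D i) (K := christoffel Dt i z A A) :
  usubmx K = G x (usubmx A) (usubmx A)
     - curvature D p (vertical G z A) (phi p v) (usubmx A)
  /\ vertical G z K = nabla_vertical G z A A.
Proof.
have ip : chart_dom i p := mfd_pchart M p.
have ix : chart_img i x by exact: chart_img_coord.
have uz : usubmx z = x by rewrite col_mxKu.
have dz : dsubmx z = v by rewrite col_mxKd.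
have iz : chart_img (i : chart TB) z.
  by exists (p, v) => //=; rewrite to_chart_pchart.
have Uz : chart_img i (usubmx z) by rewrite uz.
have near_z : \forall y \near z, chart_img i (usubmx y).
  apply: continuous_usubmx; apply: open_nbhs_nbhs; split => //.
  exact: mfd_img_open M _.
pose h y u w := form_in g i y u (endo_in phi i y w).
have totalE y X Y : chart_img i (usubmx y) ->
    form_in (phi_sasaki D phi g) (i : chart TB) y X Y
    = total_form G (form_in g i) h y X Y by exact: phi_sasaki_in.
have oU : open (chart_img i) by exact: mfd_img_open M _.
have Gr y u : linear (G y u) := christoffel_linearr D i y u.
have Gsym y u w : chart_img i y -> G y u w = G y w u.
  by apply: christoffel_sym; exact: lc_torsion_free lcD.
have dG y u w : chart_img i y -> differentiable (fun r => G r u w) y.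
  exact: christoffel_differentiable.
have pg := parallel_form_metric M rg lcD i.
have ph := parallel_form_twisted M rg lcD tphi pphi i.
have := @total_form_spray R n (chart_img i) G oU Gr Gsym dG (form_in g i) h pg ph
  (christoffel Dt i z) z A (phi p) Uz.
rewrite uz dz /curvature curvature_field_cst; apply.
- by move=> u w; rewrite !form_in_pchart (riem_sym rg).
- by move=> u; rewrite form_in_pchart; exact: (riem_pos rg).
- by move=> u w; rewrite /h endo_in_pchart !form_in_pchart.
- by move=> u w; rewrite !form_in_pchart gphi.
- exact: phiK.
- by move=> B; apply: christoffel_sym iz; exact: lc_torsion_free lcDt.
- move=> X Y Z; rewrite -!totalE//.
  rewrite -(metric_connection_cst _ _ _ (lc_metric lcDt) iz).
  by apply: near_eq_derive; apply: filterS near_z => y iy; rewrite totalE.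
Qed.

(** Splits the geodesic equation on the tangent bundle into the two equations of the theorem. *)
Lemma lift_eq z (A B : vec2) :
  A = B <-> hpart A = hpart B /\ vpart D z A = vpart D z B.
Proof.
split=> [->//|[hE vE]].
by rewrite -(Defs.liftK D z A) -(Defs.liftK D z B) hE vE.
Qed.

Lemma hpart_hlift11 z (A : vec2) : hpart (hlift11 D F z A) = F z.1 (hpart A).
Proof.
by rewrite /hlift11 /hlift /vlift add_col_mx /hpart col_mxKu addr0.
Qed.

Lemma vpart_hlift11 z (A : vec2) : vpart D z (hlift11 D F z A) = F z.1 (vpart D z A).
Proof.
rewrite [in LHS]/vpart /hlift11 /hlift /vlift add_col_mx col_mxKu col_mxKd addr0.
by rewrite addrAC addNr add0r.
Qed.

Variables (J : set R) (gam : R -> T) (xi : R -> vec).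
Hypotheses (smooth_gam : smooth_curve C J gam) (smooth_xi : smooth_along C J gam xi).
Local Notation gam' := (velocity C gam).
Local Notation xi' := (covariant_derivative D gam xi).

(** By definition the velocities near [t] are converted from their own distinguished charts; near
    [t] this conversion gives the coordinate derivative in the fixed chart. *)
Lemma acceleration_pchart t (i := pchart C (gam t)) : J t ->
  covariant_derivative D gam gam' t
  = derive1 (derive1 (chart_coord i \o gam)) t
    + christoffel D i (chart_coord i (gam t)) (gam' t) (gam' t).
Proof.
move=> Jt.
suff <- : derive1 (fun s => to_chart i (gam s) (gam' s)) t
    = derive1 (derive1 (chart_coord i \o gam)) t by [].
rewrite !derive1E; apply: near_eq_derive.
have it : chart_dom i (gam t) := mfd_pchart M _.
apply: filterS (curve_near_chart smooth_gam Jt it) => s [Js is_].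
exact: (to_chart_velocity M smooth_gam).
Qed.

(** Near [t] the first covariant derivative is w' + Gamma(c', w) in the fixed chart, with c the
    coordinates of the curve; the bilinear Leibniz rule gives the bracketed terms. *)
Lemma second_derivative_pchart t (i := pchart C (gam t))
    (G := christoffel D i) (x := chart_coord i (gam t))
    (w := fun s => to_chart i (gam s) (xi s)) : J t ->
  covariant_derivative D gam xi' t
  = derive1 (derive1 w) t
    + ('D_(gam' t) (fun y => G y (gam' t) (xi t)) x
       + G x (gam' t) (derive1 w t)
       + G x (derive1 (derive1 (chart_coord i \o gam)) t) (xi t))
    + G x (gam' t) (xi' t).
Proof.
move=> Jt; have it : chart_dom i (gam t) := mfd_pchart M _.
suff E : derive1 (fun s => to_chart i (gam s) (xi' s)) t
    = derive1 (derive1 w) t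
    + ('D_(gam' t) (fun y => G y (gam' t) (xi t)) x
       + G x (gam' t) (derive1 w t)
       + G x (derive1 (derive1 (chart_coord i \o gam)) t) (xi t)).
  by rewrite -E.
set c := chart_coord i \o gam.
have dc := curve_is_derive smooth_gam Jt it.
have dc2 := curve_is_derive2 smooth_gam Jt it.
have dw := fibre_is_derive smooth_xi Jt it.
have dw2 := fibre_is_derive2 smooth_xi Jt it.
have ix : chart_img i (c t) by exact: chart_img_coord.
have dGc u v : is_derive t 1 (fun s => G (c s) u v)
    ('D_(derive1 c t) (fun y => G y u v) (c t)).
  by apply: (is_derive_comp dc); exact: christoffel_differentiable.
have linl : \forall s \near t, forall v, linear (G (c s) ^~ v).
  by near=> s => v; exact: christoffel_linearl.
have linr : \forall s \near t, forall v, linear (G (c s) v).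
  by near=> s => v; exact: christoffel_linearr.
have dG := is_derive_bilin_app linl linr (dGc (derive1 c t) (w t))
  (fun u v => @ex_derive _ _ _ _ _ _ _ (dGc u v)) dc2 dw.
have -> : gam' t = derive1 c t by [].
have -> : xi t = w t by rewrite /w to_chart_pchart.
have H := is_deriveD dw2 dG.
rewrite -(@derive_val _ _ _ _ _ _ _ H) derive1E.
apply: near_eq_derive.
apply: filterS (curve_near_chart smooth_gam Jt it) => s [Js is_].
rewrite (to_chart_covariant_derivative M smooth_gam cD Js is_)//.
have ks : chart_dom (pchart C (gam s)) (gam s) := mfd_pchart M _.
by have [] := fibre_is_derive smooth_xi Js ks.
Unshelve. all: by end_near. Qed.

Lemma tangent_acceleration_parts t (Gam := fun s => (gam s, xi s))
    (N := covariant_derivative Dt Gam (velocity TB Gam) t) : J t ->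
  [/\ hpart (velocity TB Gam t) = gam' t,
      vpart D (Gam t) (velocity TB Gam t) = xi' t,
      hpart N = covariant_derivative D gam gam' t
                - curvature D (gam t) (xi' t) (phi (gam t) (xi t)) (gam' t) &
      vpart D (Gam t) N = covariant_derivative D gam xi' t].
Proof.
move=> Jt; pose i := pchart C (gam t); pose G := christoffel D i.
pose x := chart_coord i (gam t).
have [velE NE] := covariant_derivative_tangent M smooth_gam smooth_xi Dt Jt.
rewrite -/i in velE NE.
have wE : to_chart i (gam t) (xi t) = xi t by rewrite to_chart_pchart.
have hE : hpart (velocity TB Gam t) = gam' t by rewrite velE /hpart col_mxKu.
have vE : vpart D (Gam t) (velocity TB Gam t) = xi' t.
  by rewrite velE /vpart col_mxKu col_mxKd.
have [] := christoffel_spray (gam t) (xi t) (velocity TB Gam t).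
have vertE : vertical G (col_mx x (xi t)) (velocity TB Gam t) = xi' t.
  by rewrite -vE /vertical !col_mxKu !col_mxKd.
set A := velocity TB Gam t in hE vE vertE NE *.
have AE : usubmx A = gam' t := hE.
have Ad : dsubmx A = derive1 (fun s => to_chart i (gam s) (xi s)) t.
  by have -> : A = _ := velE; rewrite col_mxKd.
rewrite /nabla_vertical -/i -/x -/G vertE AE Ad col_mxKu col_mxKd.
have zE : col_mx ((chart_coord i \o gam) t) (to_chart i (gam t) (xi t)) = col_mx x (xi t).
  by rewrite wE.
rewrite zE in NE; set K := christoffel Dt i _ A A in NE *.
rewrite {1}/vertical !col_mxKu !col_mxKd => hK vK.
have uN : usubmx N = derive1 (derive1 (chart_coord i \o gam)) t + usubmx K.
  by rewrite /N NE linearD/= col_mxKu.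
have dN : dsubmx N = derive1 (derive1 (fun s => to_chart i (gam s) (xi s))) t + dsubmx K.
  by rewrite /N NE linearD/= col_mxKd.
split=> //.
  by rewrite /hpart uN hK acceleration_pchart// addrA.
rewrite /vpart -/i -/x -/G uN dN (second_derivative_pchart Jt) -/i -/x -/G -[(Gam t).2]/(xi t).
have -> u v : G x (u + v) (xi t) = G x u (xi t) + G x v (xi t).
  by have /= := christoffel_linearl D i x (xi t) 1 u v; rewrite !scale1r.
move: vK.
(* [s] is Gamma(c'', w): on the left it comes from the base acceleration inside the vertical part,
   on the right from differentiating Gamma(c', w). The remaining terms are those of
   [nabla_vertical]. *)
have L (w2 d p q r s k2 : vec) :
    d + k2 = q + (p + r) -> w2 + d + (s + k2) = w2 + (p + r + s) + q.
  move=> E; rewrite addrACA E.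
  by apply/matrixP => a b; rewrite !mxE; ring.
exact: L.
Qed.

End Geodesics.

Theorem theorem5p3 (R : realType) (m : nat) (T : topologicalType)
    (C : charted R (m + m) T)
    (g : T -> 'cV[R]_(m + m) -> 'cV[R]_(m + m) -> R)
    (D : symbols C)
    (phi F : T -> 'cV[R]_(m + m) -> 'cV[R]_(m + m))
    (Dt : symbols (tangent_bundle C))
    (J : set R) (gam : R -> T) (xi : R -> 'cV[R]_(m + m)) :
  para_Kahler_Norden g D phi ->
  levi_civita Dt (phi_sasaki D phi g) ->
  tensor11 C F ->
  is_interval J -> open J ->
  smooth_curve C J gam -> smooth_along C J gam xi ->
  let gam' := velocity C gam in
  let gam'' := covariant_derivative D gam gam' in
  let xi' := covariant_derivative D gam xi in
  let xi'' := covariant_derivative D gam xi' in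
  F_geodesic Dt (hlift11 D F) J (fun t => (gam t, xi t)) <->
  (forall t, J t ->
    gam'' t = curvature D (gam t) (xi' t) (phi (gam t) (xi t)) (gam' t)
              + F (gam t) (gam' t)
    /\ xi'' t = F (gam t) (xi' t)).
Proof.
move=> pkn lcDt _ _ _ sgam sxi gam' gam'' xi' xi''.
have parts t (Jt : J t) := tangent_acceleration_parts (pkn_manifold pkn)
  (pkn_metric pkn) (pkn_levi_civita pkn) (pkn_tensor pkn) (pkn_parallel pkn)
  (pkn_invol pkn) (pkn_pure pkn) lcDt sgam sxi Jt.
split=> geo t Jt; have [hA vA hN vN] := parts t Jt.
  have /(lift_eq D (gam t, xi t))[hE vE] := geo t Jt.
  rewrite hpart_hlift11 hN hA in hE; rewrite vpart_hlift11 vN vA in vE.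
  split; last exact: vE.
  by rewrite addrC; apply/eqP; rewrite -subr_eq; apply/eqP; exact: hE.
have [gE xE] := geo t Jt.
apply/(lift_eq D (gam t, xi t)).
rewrite hpart_hlift11 vpart_hlift11 hN hA vN vA; split; last exact: xE.
by apply/eqP; rewrite subr_eq addrC; apply/eqP; exact: gE.
Qed.
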